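(* Let $\mathcal A$ be a van Hove sequence in $G$ and let $\mu,\nu\in\mathcal{M}^\infty(G)$ be such that the twisted Eberlein convolution $[\mu,\nu]_{\mathcal A}$ is well defined. (a) If $\mu$ is mean almost periodic with respect to $\mathcal A$, then $[\mu,\nu]_{\mathcal A}$ is a strongly almost periodic measure. (b) If $\nu$ is mean almost periodic with respect to $\mathcal A$, then $[\mu,\nu]_{\mathcal A}$ is a strongly almost periodic measure.
   Context: $G$ is a second countable, locally compact (Hausdorff) Abelian group with Haar measure $|\cdot|$. A van Hove sequence is a sequence $\mathcal A=(A_n)_{n\in\mathbb N}$ of precompact open subsets of $G$ (of positive measure) such that $\lim_{n}|\partial^K A_n|/|A_n|=0$ for each compact $K\subseteq G$, where for open $A$, $\partial^K A:=(\overline{A+K}\setminus A)\cup(((G\setminus A)-K)\cap\overline A)$. A measure on $G$ is a complex Radon measure, viewed as a linear functional on $C_c(G)$; $|\mu|$ denotes its variation measure. $\mathcal M^\infty(G)$ is the set of translation bounded measures, i.e. those with $\sup_{t\in G}|\mu|(t+K)<\infty$ for every compact $K$. For $\varphi\in C_c(G)$, $(\mu*\varphi)(t)=\int_G\varphi(t-s)\,d\mu(s)$. For $g$ on $G$ put $\widetilde g(x)=\overline{g(-x)}$, and for a measure $\widetilde\mu(g)=\overline{\mu(\widetilde g)}$. The Eberlein convolution is $\mu\circledast_{\mathcal A}\nu:=\lim_{n\to\infty}\frac1{|A_n|}(\mu|_{A_n})*(\nu|_{-A_n})$ if this limit exists in the vague topology, and the twisted Eberlein convolution is $[\mu,\nu]_{\mathcal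 A}:=\mu\circledast_{\mathcal A}\widetilde\nu$ if it exists. $C_u(G)$ is the space of bounded uniformly continuous functions $G\to\mathbb C$; $(\tau_tf)(x)=f(x-t)$. A function $f\in C_u(G)$ is strongly almost periodic if the closure of $\{\tau_tf:t\in G\}$ in $(C_u(G),\|\cdot\|_\infty)$ is compact; a measure $\mu$ is strongly almost periodic if $\mu*\varphi$ is a strongly almost periodic function for all $\varphi\in C_c(G)$. For $f\in L^1_{\mathrm{loc}}(G)$ let $\|f\|_{b,1,\mathcal A}:=\limsup_{n}\frac1{|A_n|}\int_{A_n}|f(t)|\,dt$; let $BL^1_{\mathcal A}(G)$ be the space of $f$ with $\|f\|_{b,1,\mathcal A}<\infty$ and $BC^1_{\mathcal A}(G)$ the closure of $C_u(G)$ in it. $\mathrm{MAP}_{\mathcal A}(G)$ is the set of $f\in C_u(G)$ such that for each $\varepsilon>0$ the set $\{t\in G:\|f-\tau_tf\|_{b,1,\mathcal A}<\varepsilon\}$ is relatively dense, and $\mathrm{Map}^1_{\mathcal A}(G)$ is the closure of $\mathrm{MAP}_{\mathcal A}(G)$ in $BC^1_{\mathcal A}(G)$ with respect to $\|\cdot\|_{b,1,\mathcal A}$. A measure $\mu$ is mean almost periodic with respect to $\mathcal A$ if $\mu*\varphi\in\mathrm{Map}^1_{\mathcal A}(G)$ for all $\varphi\in C_c(G)$. *)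

(* Defs.v *)
From HB Require Import structures.
From mathcomp Require Import all_boot all_order all_algebra.
From mathcomp Require Import all_classical all_reals all_analysis.
From mathcomp Require Import measurable_realfun complex ring.

Set Implicit Arguments.
Unset Strict Implicit.
Unset Printing Implicit Defensive.

Import Order.TTheory GRing.Theory Num.Theory.
Import numFieldNormedType.Exports.
Import Normc.

Local Open Scope classical_set_scope.
Local Open Scope ring_scope.
Local Open Scope complex_scope.

(* The topology of the complex numbers is that of the norm of R[i]. *)
#[non_forgetful_inheritance]
HB.instance Definition _ (R : rcfType) := NormedModule.copy R[i] (R[i]^o).

(* [measurableType] asks for a base point. *)
#[non_forgetful_inheritance]
HB.instance Definition _ (G : topologicalZmodType) := isPointed.Build G 0.

Definition borel (G : topologicalZmodType) := g_sigma_algebraType (@open G).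

(* G is meant to be a second countable locally compact Hausdorff group: there,
   every positive Borel measure that is finite on compact sets is regular, so
   that no regularity has to be required. *)
Record radon (G : topologicalZmodType) (R : realType) := Radon {
  radon_measure :> {measure set (borel G) -> \bar R} ;
  radon_compact : forall K : set G, compact K -> (radon_measure K < +oo)%E
}.

(* The complex Radon measure re_pos - re_neg + i (im_pos - im_neg).  The four
   parts are not required to be mutually singular, so the same measure has
   many representatives; everything below depends only on the measure. *)
Record cradon (G : topologicalZmodType) (R : realType) := CRadon {
  re_pos : radon G R ;
  re_neg : radon G R ;
  im_pos : radon G R ;
  im_neg : radon G R
}.

Section Measures.
Context {G : topologicalZmodType} {R : realType}.
Implicit Types (mu nu : cradon G R) (f g phi : G -> R[i]) (A B K : set G).

Definition is_haar (m : radon G R) :=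
  m [set: G] != 0%E /\
  forall (t : G) (B : set (borel G)), measurable B ->
    m [set t + x | x in B] = m B.

Definition cintegral (m : radon G R) B f : R[i] :=
  (\int[m]_(x in (B : set (borel G))) complex.Re (f x)) +i*
  (\int[m]_(x in (B : set (borel G))) complex.Im (f x)).

(* The integral of f against the restriction of mu to B; as a functional on
   C_c(G), mu is [cint mu setT]. *)
Definition cint mu B f : R[i] :=
  cintegral (re_pos mu) B f - cintegral (re_neg mu) B f +
  'i * (cintegral (im_pos mu) B f - cintegral (im_neg mu) B f).

(* mu(E), for a precompact Borel set E *)
Definition cval mu (E : set G) : R[i] :=
  (fine (re_pos mu E) - fine (re_neg mu E)) +i*
  (fine (im_pos mu E) - fine (im_neg mu E)).

(* |mu|(B): the pieces are precompact because mu(E) makes no sense for a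
   general Borel set E. *)
Definition variation mu B : \bar R :=
  ereal_sup [set s | exists n (E : 'I_n -> set (borel G)),
    [/\ forall i, measurable (E i) /\ precompact (E i : set G),
        trivIset setT E,
        forall i, E i `<=` B &
        s = (\sum_(i < n) normc (cval mu (E i)))%:E]].

Definition translation_bounded mu :=
  forall K, compact K ->
    (ereal_sup (range (fun t : G => variation mu [set (t + x)%R | x in K]))
      < +oo)%E.

Definition Cc phi := continuous phi /\ compact (closure [set x | phi x != 0]).

Definition conv_fun mu phi : G -> R[i] :=
  fun t => cint mu setT (fun s => phi (t - s)).

Lemma measurable_opp_borel :
  measurable_fun [set: borel G] (-%R : borel G -> borel G).
Proof.
apply: (@measurability _ _ (borel G) (borel G) setT _ (@open G)) => //.
move=> _ [U oU <-]; rewrite setTI; apply: sub_sigma_algebra.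
by have /continuousP := @opp_continuous G; exact.
Qed.

Lemma compact_opp K : compact K -> compact (-%R @^-1` K).
Proof.
move=> cK; have -> : -%R @^-1` K = -%R @` K.
  apply/seteqP; split => [x Kx|_ [x Kx <-]] /=; last by rewrite opprK.
  by exists (- x) => //; rewrite opprK.
by apply: continuous_compact => //; apply: continuous_subspaceT => x;
  exact: opp_continuous.
Qed.

Section Reflection.
Variable m : radon G R.

Definition reflection : set (borel G) -> \bar R :=
  pushforward m (-%R : borel G -> borel G).

Let reflection0 : reflection set0 = 0%E.
Proof. by rewrite /reflection /pushforward preimage_set0 measure0. Qed.

Let reflection_ge0 B : (0 <= reflection B)%E.
Proof. exact: (measure_ge0 m). Qed.

Let reflection_sigma_additive : semi_sigma_additive reflection.
Proof.
exact: (@measure_semi_sigma_additive _ _ _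
  (measure_function_pushforward__canonical__measure_function_Measure
    m measurable_opp_borel)).
Qed.

HB.instance Definition _ := isMeasure.Build _ _ _ reflection
  reflection0 reflection_ge0 reflection_sigma_additive.

Lemma reflection_compact K : compact K -> (reflection K < +oo)%E.
Proof. by move=> /compact_opp; exact: radon_compact. Qed.

Definition radon_reflection : radon G R := Radon reflection_compact.

End Reflection.

Definition star f : G -> R[i] := fun x => conjc (f (- x)).

(* The measure g |-> conjc (nu (star g)), see [cstarE]. *)
Definition cstar nu : cradon G R :=
  CRadon (radon_reflection (re_pos nu)) (radon_reflection (re_neg nu))
         (radon_reflection (im_neg nu)) (radon_reflection (im_pos nu)).

Lemma continuous_Re f : continuous f -> continuous (fun x => complex.Re (f x)).
Proof.
move=> cf x; apply/cvgrPdist_lt => e e0.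
have /cvgrPdist_lt/(_ e%:C) := cf x.
rewrite ltcR => /(_ e0); apply: filterS => y.
rewrite -ltcR; apply: le_lt_trans.
by rewrite -raddfB; exact: normc_ge_Re.
Qed.

Lemma continuous_Im f : continuous f -> continuous (fun x => complex.Im (f x)).
Proof.
move=> cf x; apply/cvgrPdist_lt => e e0.
have /cvgrPdist_lt/(_ e%:C) := cf x.
rewrite ltcR => /(_ e0); apply: filterS => y.
rewrite -ltcR; apply: le_lt_trans.
rewrite -raddfB/=; case: (f x - f y) => a b.
rewrite normc_def lecR -[X in X <= _]sqrtr_sqr.
by rewrite ler_sqrt ?addr_ge0 ?sqr_ge0// lerDr sqr_ge0.
Qed.

Lemma measurable_continuous_borel (f : G -> R) :
  continuous f -> measurable_fun [set: borel G] (f : borel G -> R).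
Proof.
move=> /continuousP cf.
apply: (measurability _ (RGenOpens.measurableE R)).
move=> _ [_ [a [b ->]] <-]; rewrite setTI; apply: sub_sigma_algebra.
by apply: cf; exact: interval_open.
Qed.

Lemma Rintegral_reflection (m : radon G R) (f : G -> R) : continuous f ->
  (\int[radon_reflection m]_(x in [set: borel G]) f x)%R =
  (\int[m]_(x in [set: borel G]) f (- x))%R.
Proof.
move=> /measurable_continuous_borel mf; rewrite /Rintegral; congr fine.
have mEf : measurable_fun [set: borel G] (EFin \o f) by exact/measurable_EFinP.
rewrite integralE [RHS]integralE; congr (_ - _)%E.
- rewrite [LHS](ge0_integral_pushforward measurable_opp_borel)//.
    by apply: eq_integral => x _; rewrite -funepos_comp.
  exact: (measurable_funepos mEf).
- rewrite [LHS](ge0_integral_pushforward measurable_opp_borel)//.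
    by apply: eq_integral => x _; rewrite -funeneg_comp.
  exact: (measurable_funeneg mEf).
Qed.

Lemma RintegralN (m : radon G R) (f : G -> R) :
  (\int[m]_(x in [set: borel G]) (- f x))%R =
  - (\int[m]_(x in [set: borel G]) f x)%R.
Proof.
rewrite /Rintegral integralE [in RHS]integralE.
under eq_integral => x _.
  rewrite (_ : _^\+%E x = (EFin \o f)^\-%E x); last first.
    by rewrite -funeposN.
  over.
under [X in (_ - X)%E]eq_integral => x _.
  rewrite (_ : _^\-%E x = (EFin \o f)^\+%E x); last first.
    by rewrite -funenegN.
  over.
set a := integral _ _ _; set b := integral _ _ _.
have : (0 <= a)%E by apply: integral_ge0.
have : (0 <= b)%E by apply: integral_ge0.
by case: a b => [a| |] [b| |] //= _ _; rewrite ?oppr0// opprB.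
Qed.


Lemma cintegral_reflection (m : radon G R) f : continuous f ->
  cintegral (radon_reflection m) setT f =
  conjc (cintegral m setT (star f)).
Proof.
move=> cf; rewrite /cintegral /conjc; congr Complex.
- rewrite Rintegral_reflection; last exact: continuous_Re.
  by apply: eq_Rintegral => x _; rewrite /star; case: (f (- x)).
- rewrite Rintegral_reflection; last exact: continuous_Im.
  rewrite -RintegralN.
  by apply: eq_Rintegral => x _; rewrite /star; case: (f (- x)) => a b /=;
    rewrite opprK.
Qed.

Lemma cstarE nu g : continuous g ->
  cint (cstar nu) setT g = conjc (cint nu setT (star g)).
Proof.
move=> cg; rewrite /cint /= !cintegral_reflection//.
rewrite /cintegral /conjc; simpc; congr Complex; ring.
Qed.

End Measures.

Section AlmostPeriodicity.
Context {G : topologicalZmodType} {R : realType}.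
Implicit Types (mu nu lambda : cradon G R) (f g phi : G -> R[i]).
Implicit Types (B K : set G) (A : nat -> set G).

Definition van_hove_boundary K B : set G :=
  (closure [set (x + k)%R | x in B & k in K] `\` B) `|`
  ([set (x - k)%R | x in ~` B & k in K] `&` closure B).

Definition van_hove (haar : radon G R) A :=
  [/\ forall n, open (A n),
      forall n, precompact (A n),
      forall n, (0 < haar (A n))%E &
      forall K, compact K ->
        (haar (van_hove_boundary K (A n)) / haar (A n))%E @[n --> \oo] --> 0%E].

(* The value at phi of the convolution of mu restricted to B with nu
   restricted to B'. *)
Definition conv_restr mu B nu (B' : set G) phi : R[i] :=
  cint mu B (fun s => cint nu B' (fun t => phi (s + t))).

(* lambda is the vague limit defining the Eberlein convolution of mu and nu *)
Definition eberlein_convolution (haar : radon G R) A mu nu lambda :=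
  forall phi, Cc phi ->
    ((fine (haar (A n)))^-1)%:C *
      conv_restr mu (A n) nu [set - x | x in A n] phi @[n --> \oo]
    --> cint lambda setT phi.

Definition twisted_eberlein_convolution (haar : radon G R) A mu nu lambda :=
  eberlein_convolution haar A mu (cstar nu) lambda.

Definition Cu f :=
  (exists M : R, forall x, normc (f x) <= M) /\
  (forall e : R, 0 < e ->
    \forall u \near (0 : G), forall x, normc (f (x + u) - f x) < e).

Definition translate (t : G) f : G -> R[i] := fun x => f (x - t).

(* {uniform G -> R[i]} carries the topology of uniform convergence, which is
   that of the sup norm on Cu; intersecting the closure with Cu gives the
   closure in Cu. *)
Definition strongly_almost_periodic_fun f :=
  Cu f /\
  compact (closure (range (translate ^~ f : G -> {uniform G -> R[i]}))
           `&` (Cu : set {uniform G -> R[i]})).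

Definition strongly_almost_periodic mu :=
  forall phi, Cc phi -> strongly_almost_periodic_fun (conv_fun mu phi).

Definition relatively_dense (S : set G) :=
  exists2 K : set G, compact K & [set s + k | s in S & k in K] = setT.

Variables (haar : radon G R) (A : nat -> set G).

Definition L1loc f :=
  forall K, compact K ->
    haar.-integrable (K : set (borel G)) (fun x => (complex.Re (f x))%:E) /\
    haar.-integrable (K : set (borel G)) (fun x => (complex.Im (f x))%:E).

Definition bnorm f : \bar R :=
  limn_esup (fun n =>
    (\int[haar]_(x in (A n : set (borel G))) (normc (f x))%:E / haar (A n))%E).

Definition BL1 f := L1loc f /\ (bnorm f < +oo)%E.

Definition BC1 f :=
  BL1 f /\
  forall e : R, 0 < e -> exists2 g, Cu g & (bnorm (f \- g)%R < e%:E)%E.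

Definition MAP f :=
  Cu f /\
  forall e : R, 0 < e ->
    relatively_dense [set t | (bnorm (f \- translate t f)%R < e%:E)%E].

Definition Map1 f :=
  BC1 f /\
  forall e : R, 0 < e -> exists2 g, MAP g & (bnorm (f \- g)%R < e%:E)%E.

Definition mean_almost_periodic mu :=
  forall phi, Cc phi -> Map1 (conv_fun mu phi).

End AlmostPeriodicity.

(* Main.v *)
(* Write h for the complex conjugate of nu * phi~, where phi~(x) is the conjugate
   of phi(-x).  By the van Hove property the restriction of nu to A_n may be
   dropped from the Eberlein convolution, so that, for lambda = [mu, nu],
     (lambda * phi)(t) = lim_n |A_n|^-1 \int_(A_n) h(s - t) dmu(s).
   If nu is mean almost periodic, then h is bounded, uniformly continuous and has
   relatively dense sets of tau for which the mean of |h - h_tau| is small, where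
   h_tau(x) = h(x - tau).  Averaging over a small neighbourhood U of 0 on which
   h hardly varies bounds
     |A_n|^-1 |\int_(A_n) (h - h_tau)(s - t) dmu(s)| by a constant C(U) times
   that mean plus an arbitrarily small error, uniformly in t.  Hence lambda * phi
   is Bohr almost periodic, i.e. has a totally bounded orbit.  Exchanging mu and
   nu conjugates and reflects the limit, so (a) follows from (b).

   Integrals against mu are estimated by cutting a precompact Borel set into
   finitely many Borel pieces E_j inside translates t_j + U; this replaces Fubini's
   theorem, and of the variation only finite additivity is used. *)

Require Import Defs.
From HB Require Import structures.
From mathcomp Require Import all_boot all_order all_algebra.
From mathcomp Require Import all_classical all_reals all_analysis.
From mathcomp Require Import measurable_realfun complex ring lra.

Set Implicit Arguments.
Unset Strict Implicit.
Unset Printing Implicit Defensive.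

Import Order.TTheory GRing.Theory Num.Theory.
Import numFieldNormedType.Exports.
Import Normc.

Local Open Scope classical_set_scope.
Local Open Scope ring_scope.
Local Open Scope complex_scope.

(* [variation] alone is the variation of a real function in [realfun]. *)
Local Notation variation := Defs.variation.

(** * Topological groups *)

Section TopologicalGroup.
Context {G : topologicalZmodType}.
Implicit Types (U V K B C : set G).

Lemma sub_cvg0 U : nbhs (0 : G) U ->
  exists2 V, open_nbhs (0 : G) V & forall a b, V a -> V b -> U (a - b).
Proof.
move=> U0; have /(_ U) := @sub_continuous G (0, 0).
rewrite /= subr0 => /(_ U0) [[P Q] /= [P0 Q0] PQ].
have : nbhs (0 : G) (P `&` Q) by exact: filterI.
rewrite nbhsE => -[V oV VPQ].
by exists V => // a b /VPQ[Pa _] /VPQ[_ Qb]; exact: (PQ (a, b)).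
Qed.

Lemma continuous_subr (t : G) : continuous (fun x : G => x - t).
Proof.
move=> x; apply: (@continuous_comp _ _ _ (fun x : G => (x, t))
  (fun x : G * G => x.1 - x.2)); last exact: sub_continuous.
by apply: cvg_pair => //; exact: cvg_cst.
Qed.

Lemma continuous_addl (t : G) : continuous (fun x : G => t + x).
Proof.
rewrite (_ : (fun _ => _) = (fun x => x - - t)); first exact: continuous_subr.
by apply/funext => x; rewrite opprK addrC.
Qed.

Lemma open_shift U t : open U -> open [set x | U (x - t)].
Proof. by move=> oU; have /continuousP := @continuous_subr t; exact. Qed.

Lemma near_shift U (t : G) : nbhs (0 : G) U -> \forall x \near t, U (x - t).
Proof. by move=> U0; apply: continuous_subr; rewrite subrr. Qed.

Lemma nbhs0N U : nbhs (0 : G) U -> \forall x \near (0 : G), U (- x).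
Proof. by move=> U0; apply: opp_continuous; rewrite oppr0. Qed.

Lemma image_addl (t : G) B : [set t + x | x in B] = [set x | B (x - t)].
Proof.
apply/seteqP; split=> [_ [x Bx <-]|x /= Bx] /=; first by rewrite addrC addKr.
by exists (x - t) => //; rewrite addrC subrK.
Qed.

Lemma image_oppr B : [set - x | x in B] = [set x | B (- x)].
Proof.
apply/seteqP; split=> [_ [x Bx <-]|x /= Bx] /=; first by rewrite opprK.
by exists (- x) => //; rewrite opprK.
Qed.

Definition minkowski_diff B C := [set x - y | x in B & y in C].

Lemma compact_minkowski_diff K L :
  compact K -> compact L -> compact (minkowski_diff K L).
Proof.
move=> cK cL; have -> : minkowski_diff K L =
    (fun x : G * G => x.1 - x.2) @` (K `*` L).
  apply/seteqP; split=> [_ [x Kx] [y Ly <-]|_ [[x y] [/= Kx Ly] <-]].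
    by exists (x, y).
  by exists x => //; exists y.
apply: continuous_compact; last exact: compact_setX.
by apply: continuous_subspaceT; exact: sub_continuous.
Qed.

(** If [x] is outside the difference, every [x + k] with [k] in [K] lies in the open complement of
    [C], and compactness of [K] gives one neighbourhood of [x] that works for all [k]. This makes
    the second half of the van Hove boundary a Borel set. *)
Lemma closed_minkowski_diff C K :
  closed C -> compact K -> closed (minkowski_diff C K).
Proof.
move=> cC cK; rewrite -openC openE => x nCKx; rewrite /interior.
suff : \forall y \near x, K `<=` (fun k => ~ C (y + k)).
  apply: filterS => y PK [c Cc [k Kk]] yE.
  by apply: (PK k Kk); rewrite -yE subrK.
apply: (proj1 (compact_near_coveringP K) cK) => k Kk.
have nC : ~ C (x + k).
  by move=> Cxk; apply: nCKx; exists (x + k) => //; exists k => //; rewrite addrK.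
have /(_ (k, x)) := @add_continuous G => /(_ (~` C)) /=.
rewrite addrC => /(_ (open_nbhs_nbhs (conj (closed_openC cC) nC))).
move=> [[P Q] /= [Pk Qx] PQ]; exists (P, Q) => //= -[a b] [/= Pa Qb].
by have := PQ (a, b) (conj Pa Qb); rewrite /= addrC.
Qed.

Lemma compact_shift (t : G) K : compact K -> compact [set t + x | x in K].
Proof.
move=> cK; apply: continuous_compact => //; apply: continuous_subspaceT.
exact: continuous_addl.
Qed.

Lemma precompact_cover B U : precompact B -> nbhs (0 : G) U ->
  exists n (t : nat -> G),
    B `<=` \bigcup_(i < n) [set x | U (x - t i)].
Proof.
rewrite precompactE => cB /nbhs_interior.
move=> /nbhs_singleton U0.
have := cB; rewrite compact_cover => /(_ G setT
  (fun t => [set x | (interior U) (x - t)])) [].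
- by move=> i _; apply: open_shift; exact: open_interior.
- by move=> x _; exists x => //=; rewrite subrr; exact: U0.
move=> D _ BD; pose s := finmap.enum_fset D; exists (size s), (nth 0 s).
move=> x /subset_closure/BD[y /= Dy Uxy].
exists (index y s); first by rewrite /= index_mem.
by rewrite /= nth_index//; exact: interior_subset Uxy.
Qed.

End TopologicalGroup.

(** * Complex functions and their integrals *)

Section ComplexModulus.
Context {R : realType}.
Implicit Types z w : R[i].

Lemma normc_norm z : (normc z)%:C = `|z|.
Proof. by case: z. Qed.

Lemma normcD z w : normc (z + w) <= normc z + normc w.
Proof. exact: le_normcD. Qed.

Lemma normcN z : normc (- z) = normc z.
Proof. exact: normcN. Qed.

Lemma normcB z w : normc (z - w) <= normc z + normc w.
Proof. by rewrite -[normc w]normcN; exact: normcD. Qed.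

Lemma normc_ler_sub z w : normc z - normc w <= normc (z - w).
Proof. by rewrite lerBlDr -{1}(subrK w z) normcD. Qed.

Lemma normc_distC z w : normc (z - w) = normc (w - z).
Proof. by rewrite -normcN opprB. Qed.

Lemma normc_ge0 z : 0 <= normc z.
Proof. by case: z => a b; exact: sqrtr_ge0. Qed.

Lemma normcJ z : normc (conjc z) = normc z.
Proof. by case: z => a b; rewrite /= sqrrN. Qed.

Lemma normc_triangle z w v : normc (z - v) <= normc (z - w) + normc (w - v).
Proof.
by rewrite (_ : z - v = (z - w) + (w - v)) ?normcD// addrA subrK.
Qed.

Lemma normr_Re z : `|complex.Re z| <= normc z.
Proof. by rewrite -lecR (le_trans (normc_ge_Re z))// normc_norm. Qed.

Lemma normr_Im z : `|complex.Im z| <= normc z.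
Proof.
case: z => a b; rewrite -[X in X <= _]sqrtr_sqr /=.
by rewrite ler_sqrt ?addr_ge0 ?sqr_ge0// lerDr sqr_ge0.
Qed.

Lemma normc_real (a : R) : normc a%:C = `|a|.
Proof. by rewrite /= expr0n/= addr0 sqrtr_sqr. Qed.

Lemma normc_i : normc ('i : R[i]) = 1.
Proof. by rewrite /= expr0n/= add0r expr1n sqrtr1. Qed.

Lemma normc_ReIm z : normc z <= `|complex.Re z| + `|complex.Im z|.
Proof.
rewrite -[normc z]/(normc z) {1}(complexE z) (le_trans (normcD _ _))//.
by rewrite normc_real normcM normc_i mul1r normc_real.
Qed.

Lemma normc_sum I (r : seq I) (F : I -> R[i]) :
  normc (\sum_(i <- r) F i) <= \sum_(i <- r) normc (F i).
Proof.
elim/big_ind2: _ => // [|x a y b xa yb]; first by rewrite normc0.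
by rewrite (le_trans (normcD _ _))// lerD.
Qed.

Lemma cvg_normcP (u : nat -> R[i]) z : u @ \oo --> z <->
  forall e : R, 0 < e -> \forall n \near \oo, normc (z - u n) < e.
Proof.
split=> [uz e e0|uz].
  have /cvgrPdist_lt/(_ e%:C) := uz; rewrite ltcR => /(_ e0).
  by apply: filterS => n; rewrite -normc_norm ltcR.
(* The order of [R[i]] only compares numbers with equal imaginary parts, so a positive [e] is real
   and may be replaced by its real part. *)
apply/cvgrPdist_lt => e e0; have := e0.
rewrite ltcE => /andP[/eqP ie re]; have := uz _ re.
apply: filterS => n; rewrite -normc_norm ltcE /= => ->.
by rewrite andbT; apply/eqP; rewrite ie.
Qed.

End ComplexModulus.

(** * Bounded uniformly continuous functions *)

Section UniformlyContinuousFunctions.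
Context {G : topologicalZmodType} {R : realType}.
Implicit Types (f g : G -> R[i]).

Lemma normc_continuous f :
  (forall x (e : R), 0 < e -> \forall y \near x, normc (f x - f y) < e) ->
  continuous f.
Proof.
move=> fc x; apply/cvgrPdist_lt => e e0; have := e0.
rewrite ltcE => /andP[/eqP ie re]; have := fc x _ re.
apply: filterS => n; rewrite -normc_norm ltcE /= => ->.
by rewrite andbT; apply/eqP; rewrite ie.
Qed.

Lemma Cu_continuous f : Cu f -> continuous f.
Proof.
move=> [_ fu]; apply: normc_continuous => x e e0.
have := near_shift x (fu _ e0); apply: filterS => y /(_ x).
by rewrite addrCA subrr addr0 normc_distC.
Qed.

Lemma Cu_cst c : Cu (fun _ : G => c : R[i]).
Proof.
split; first by exists (normc c).
by move=> e e0; near=> u => x; rewrite subrr normc0.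
Unshelve. all: by end_near. Qed.

Lemma CuB f g : Cu f -> Cu g -> Cu (fun x => f x - g x).
Proof.
move=> [[M fM] fu] [[N gN] gu]; split.
  by exists (M + N) => x; rewrite (le_trans (normcB _ _))// lerD.
move=> e e0; have e20 : 0 < e / 2 by rewrite divr_gt0.
apply: filterS2 (fu _ e20) (gu _ e20) => u fe ge x.
rewrite (_ : f (x + u) - g (x + u) - (f x - g x) =
  (f (x + u) - f x) - (g (x + u) - g x)); last by ring.
by rewrite (le_lt_trans (normcB _ _))// (splitr e) ltrD.
Qed.

Lemma Cu_conj f : Cu f -> Cu (fun x => conjc (f x)).
Proof.
move=> [[M fM] fu]; split; first by exists M => x; rewrite normcJ.
move=> e e0; apply: filterS (fu _ e0) => u fe x.
by rewrite -rmorphB normcJ.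
Qed.

Lemma Cu_translate (t : G) f : Cu f -> Cu (translate t f).
Proof.
move=> [[M fM] fu]; split; first by exists M => x; exact: fM.
move=> e e0; apply: filterS (fu _ e0) => u fe x.
by rewrite /translate addrAC; exact: fe.
Qed.

Lemma Cu_opp f : Cu f -> Cu (fun x => f (- x)).
Proof.
move=> [[M fM] fu]; split; first by exists M => x; exact: fM.
move=> e e0; apply: filterS (nbhs0N (fu _ e0)) => u fe x.
by rewrite opprD; exact: fe.
Qed.

Lemma Cu_star f : Cu f -> Cu (star f).
Proof. by move=> /Cu_opp/Cu_conj. Qed.

Lemma Cu_shift (t : G) f : Cu f -> Cu (fun x => f (t + x)).
Proof.
move=> /(Cu_translate (- t)); rewrite /translate.
by congr Cu; apply/funext => x; rewrite opprK addrC.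
Qed.

End UniformlyContinuousFunctions.

(** * Integrals over precompact Borel sets *)

Section Integration.
Context {G : topologicalZmodType} {R : realType}.
Implicit Types (f g : G -> R[i]) (m : radon G R) (mu : cradon G R).
Implicit Type B : set (borel G).

Lemma open_measurable_borel (U : set G) : open U -> measurable (U : set (borel G)).
Proof. by move=> oU; exact: sub_sigma_algebra. Qed.

Lemma closed_measurable_borel (U : set G) :
  closed U -> measurable (U : set (borel G)).
Proof.
move=> cU; rewrite -[X in measurable X]setCK; apply: measurableC.
by apply: open_measurable_borel; exact: closed_openC.
Qed.

Lemma radon_precompact m B :
  measurable B -> precompact (B : set G) -> (m B < +oo)%E.
Proof.
move=> mB; rewrite precompactE => cB.
have clB : measurable (closure (B : set G) : set (borel G)).
  by apply: closed_measurable_borel; exact: closed_closure.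
apply: le_lt_trans (radon_compact m cB); apply: le_measure; rewrite ?inE//.
exact: subset_closure.
Qed.

Lemma radon_fin_num m B :
  measurable B -> precompact (B : set G) -> m B \is a fin_num.
Proof. by move=> mB pB; rewrite ge0_fin_numE// radon_precompact. Qed.

Lemma Cu_integrable m B f : measurable B -> precompact (B : set G) -> Cu f ->
  m.-integrable B (EFin \o (fun x => complex.Re (f x))) /\
  m.-integrable B (EFin \o (fun x => complex.Im (f x))).
Proof.
move=> mB pB Cf; have cf := Cu_continuous Cf; have [[M fM] _] := Cf.
have mf h : continuous (h : G -> R) -> (forall x, `|h x| <= M) ->
    m.-integrable B (EFin \o h).
  move=> ch hM; apply: measurable_bounded_integrable => //.
  - exact: radon_precompact.
  - by apply: measurable_funTS; exact: measurable_continuous_borel.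
  - exists M; split; first exact: num_real.
    by move=> x Mx y _; exact: le_trans (hM y) (ltW Mx).
split; apply: mf.
- exact: continuous_Re.
- by move=> x; exact: le_trans (normr_Re _) (fM x).
- exact: continuous_Im.
- by move=> x; exact: le_trans (normr_Im _) (fM x).
Qed.

Lemma cintegralB m B f g : measurable B -> precompact (B : set G) ->
  Cu f -> Cu g ->
  cintegral m B (fun x => f x - g x) = cintegral m B f - cintegral m B g.
Proof.
move=> mB pB Cf Cg; rewrite /cintegral.
have [fr fi] := Cu_integrable m mB pB Cf; have [gr gi] := Cu_integrable m mB pB Cg.
rewrite [RHS]/GRing.add/= -!RintegralB//.
by congr Complex; apply: eq_Rintegral => x _; case: (f x) => ? ?; case: (g x).
Qed.

Lemma cintegral_cst m B c : measurable B ->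
  cintegral m B (fun=> c) = c * (fine (m B))%:C.
Proof.
move=> mB; rewrite /cintegral !Rintegral_cst//; case: c => a b.
by simpc.
Qed.

Lemma cintegral_bigsetU m n (E : 'I_n -> set (borel G)) f :
  (forall i, measurable (E i)) -> trivIset setT E ->
  precompact (\big[setU/set0]_(i < n) E i : set G) -> Cu f ->
  cintegral m (\big[setU/set0]_(i < n) E i) f = \sum_(i < n) cintegral m (E i) f.
Proof.
move=> mE tE pE Cf.
have mB : measurable (\big[setU/set0]_(i < n) E i) by exact: bigsetU_measurable.
have pEi i : precompact (E i : set G).
  by apply: precompact_subset pE; rewrite -bigcup_seq; apply: bigcup_sup; exact: mem_index_enum.
have key (h : G -> R) : (forall B, measurable B -> precompact (B : set G) ->
    m.-integrable B (EFin \o h)) ->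
    (\int[m]_(x in \big[setU/set0]_(i < n) E i) h x)%R =
    \sum_(i < n) (\int[m]_(x in E i) h x)%R.
  move=> hi; rewrite /Rintegral integral_bigsetU_EFin ?index_enum_uniq//.
  - rewrite -sum_fine// => i _.
    by apply: integrable_fin_num => //; exact: hi.
  - by apply: sub_trivIset tE.
  - by have /integrableP[] := hi _ mB pE.
rewrite /cintegral !key; last 2 first.
- by move=> B mB' pB; have [] := Cu_integrable m mB' pB Cf.
- by move=> B mB' pB; have [] := Cu_integrable m mB' pB Cf.
elim/big_ind3: _ => //.
by move=> _ a b _ c d <- <-.
Qed.

(** The factor 2 comes from treating real and imaginary parts separately. It does no harm: the bound
    serves for finiteness and for errors that are sent to zero, and [cint_tv] recovers the constant
    1. *)
Lemma cintegral_bound m B f M : measurable B -> precompact (B : set G) ->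
  Cu f -> (forall x, B x -> normc (f x) <= M) ->
  normc (cintegral m B f) <= 2 * M * fine (m B).
Proof.
move=> mB pB Cf fM; have [fr fi] := Cu_integrable m mB pB Cf.
have fin := radon_fin_num m mB pB.
have key (h : G -> R) : m.-integrable B (EFin \o h) ->
    (forall x, B x -> `|h x| <= M) ->
    `| \int[m]_(x in B) h x |%R <= M * fine (m B).
  move=> hi hM; apply: le_trans (le_normr_Rintegral mB hi) _.
  rewrite -Rintegral_cst//; apply: le_Rintegral => //.
    by have := integrable_abse hi; apply: eq_integrable.
  apply: measurable_bounded_integrable => //; first exact: radon_precompact.
    exists `|M|; split => [|x Mx y _]; first exact: num_real.
    exact: ltW.
apply: le_trans (normc_ReIm _) _; rewrite -mulrA mulrDl !mul1r.
apply: lerD; apply: key => // x Bx.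
  exact: le_trans (normr_Re _) (fM _ Bx).
exact: le_trans (normr_Im _) (fM _ Bx).
Qed.

Lemma cintB mu B f g : measurable B -> precompact (B : set G) ->
  Cu f -> Cu g -> cint mu B (fun x => f x - g x) = cint mu B f - cint mu B g.
Proof. by move=> mB pB Cf Cg; rewrite /cint !cintegralB//; ring. Qed.

Lemma cint_cst mu B c : measurable B -> cint mu B (fun=> c) = c * cval mu B.
Proof.
move=> mB; rewrite /cint !cintegral_cst// /cval; case: c => a b; simpc.
by congr Complex; ring.
Qed.

Lemma cint_bigsetU mu n (E : 'I_n -> set (borel G)) f :
  (forall i, measurable (E i)) -> trivIset setT E ->
  precompact (\big[setU/set0]_(i < n) E i : set G) -> Cu f ->
  cint mu (\big[setU/set0]_(i < n) E i) f = \sum_(i < n) cint mu (E i) f.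
Proof.
move=> mE tE pE Cf; rewrite /cint !cintegral_bigsetU//.
by rewrite -!sumrB mulr_sumr -big_split.
Qed.

(** The total mass of the four positive parts. Unlike the variation it depends on the
    representative, but additivity and finiteness on precompact sets are immediate; it gives a first
    bound for the variation and controls errors that tend to zero. *)
Definition mass mu B : R := fine (re_pos mu B) + fine (re_neg mu B) +
  (fine (im_pos mu B) + fine (im_neg mu B)).

Lemma mass_ge0 mu B : 0 <= mass mu B.
Proof. by rewrite !addr_ge0. Qed.

Lemma cint_mass mu B f M : measurable B -> precompact (B : set G) ->
  Cu f -> (forall x, B x -> normc (f x) <= M) ->
  normc (cint mu B f) <= 2 * M * mass mu B.
Proof.
move=> mB pB Cf fM; rewrite /cint /mass !(mulrDr (2 * M)).
apply: le_trans (normcD _ _) _; rewrite normcM normc_i mul1r.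
by apply: lerD; apply: le_trans (normcB _ _) _; apply: lerD; exact: cintegral_bound.
Qed.

Lemma fine_radon_bigsetU m n (E : 'I_n -> set (borel G)) :
  (forall i, measurable (E i)) -> trivIset setT E ->
  precompact (\big[setU/set0]_(i < n) E i : set G) ->
  fine (m (\big[setU/set0]_(i < n) E i)) = \sum_(i < n) fine (m (E i)).
Proof.
move=> mE tE pE; have mB : measurable (\big[setU/set0]_(i < n) E i).
  exact: bigsetU_measurable.
apply: (@complexI R); rewrite -[LHS]mul1r -cintegral_cst//.
rewrite cintegral_bigsetU//; last exact: Cu_cst.
by rewrite rmorph_sum; apply: eq_bigr => i _; rewrite cintegral_cst// mul1r.
Qed.

Lemma mass_bigsetU mu n (E : 'I_n -> set (borel G)) :
  (forall i, measurable (E i)) -> trivIset setT E ->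
  precompact (\big[setU/set0]_(i < n) E i : set G) ->
  mass mu (\big[setU/set0]_(i < n) E i) = \sum_(i < n) mass mu (E i).
Proof. by move=> mE tE pE; rewrite /mass !fine_radon_bigsetU// -!big_split. Qed.

Lemma cval_bigsetU mu n (E : 'I_n -> set (borel G)) :
  (forall i, measurable (E i)) -> trivIset setT E ->
  precompact (\big[setU/set0]_(i < n) E i : set G) ->
  cval mu (\big[setU/set0]_(i < n) E i) = \sum_(i < n) cval mu (E i).
Proof.
move=> mE tE pE; have mB : measurable (\big[setU/set0]_(i < n) E i).
  exact: bigsetU_measurable.
rewrite -[LHS]mul1r -cint_cst// cint_bigsetU//; last exact: Cu_cst.
by apply: eq_bigr => i _; rewrite cint_cst// mul1r.
Qed.

Lemma normc_cval_mass mu B : measurable B -> precompact (B : set G) ->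
  normc (cval mu B) <= 2 * mass mu B.
Proof.
move=> mB pB; rewrite -[cval mu B]mul1r -cint_cst//.
have -> : 2 * mass mu B = 2 * 1 * mass mu B by rewrite mulr1.
by apply: cint_mass => //; [exact: Cu_cst|move=> x _; rewrite normc1].
Qed.

Lemma cint_supported mu B (D : set (borel G)) f :
  measurable B -> measurable D -> (forall x, D x -> ~ B x -> f x = 0) ->
  B `<=` D -> cint mu D f = cint mu B f.
Proof.
move=> mB mD f0 BD.
have key m (h : G -> R) : (forall x, D x -> ~ B x -> h x = 0) ->
    (\int[m : radon G R]_(x in D) h x)%R = (\int[m]_(x in B) h x)%R.
  move=> h0; rewrite Rintegral_mkcond [RHS]Rintegral_mkcond.
  apply: eq_Rintegral => x _; rewrite !patchE; case: ifPn => xD.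
    case: ifPn => // xB; apply: h0; first exact: set_mem.
    by move=> Bx; rewrite mem_set in xB.
  by rewrite ifN//; apply: contra xD; rewrite !inE; exact: BD.
have Re0 x : D x -> ~ B x -> complex.Re (f x) = 0 by move=> Dx /(f0 _ Dx) ->.
have Im0 x : D x -> ~ B x -> complex.Im (f x) = 0 by move=> Dx /(f0 _ Dx) ->.
by rewrite /cint /cintegral !key.
Qed.

End Integration.

(** * Total variation *)

Section Variation.
Context {G : topologicalZmodType} {R : realType}.
Implicit Types (f g : G -> R[i]) (m : radon G R) (mu : cradon G R).
Implicit Types (B D : set (borel G)).

Lemma sub_bigsetU n (E : 'I_n -> set (borel G)) i :
  E i `<=` \big[setU/set0]_(j < n) E j.
Proof.
by rewrite -bigcup_seq; apply: bigcup_sup; exact: mem_index_enum.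
Qed.

(** A finite cover of [B] by translates of the interior of [U] is made disjoint by removing from
    each translate the earlier ones. A piece may be empty, and [t i] need not lie in [E i] or in
    [B]. *)
Lemma fine_partition (U : set G) B : nbhs (0 : G) U ->
  measurable B -> precompact (B : set G) ->
  exists n (t : 'I_n -> G) (E : 'I_n -> set (borel G)),
    [/\ forall i, measurable (E i), trivIset setT E,
        B = \big[setU/set0]_(i < n) E i &
        forall i x, E i x -> U (x - t i)].
Proof.
move=> U0 mB pB; have := nbhs_interior U0 => U0'.
have [n [t BU]] := precompact_cover pB U0'.
pose S k : set (borel G) := [set x : G | interior U (x - t k)].
exists n, (fun i => t i), (fun i => B `&` seqDU S i); split.
- move=> i; apply: measurableI => //; apply: measurableD.
    by apply: open_measurable_borel; apply: open_shift; exact: open_interior.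
  apply: bigsetU_measurable => j _; apply: open_measurable_borel.
  by apply: open_shift; exact: open_interior.
- apply/trivIsetP => i j _ _ ij.
  rewrite setIACA setIid; have /trivIsetP -> // := @trivIset_seqDU _ S.
  by rewrite setI0.
- rewrite -big_distrr/= -bigsetU_seqDU; apply/esym/setIidPl => x /BU.
  by rewrite bigcup_mkord.
- by move=> i x [_ Sx]; apply: interior_subset; exact: (subset_seqDU Sx).
Qed.

(** An arbitrary finite index type allows two families of pieces to be joined over a sum type in
    [tvU]. *)
Lemma variation_ge mu B (I : finType) (E : I -> set (borel G)) :
  (forall i, measurable (E i)) -> (forall i, precompact (E i : set G)) ->
  trivIset setT E -> (forall i, E i `<=` B) ->
  ((\sum_i normc (cval mu (E i)))%:E <= variation mu B)%E.
Proof.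
move=> mE pE tE EB; apply: ereal_sup_ubound => /=.
exists #|I|, (fun i => E (enum_val i)); split => //.
  by move=> i j _ _ ne; apply: enum_val_inj; exact: tE ne.
by congr EFin; rewrite (reindex _ (onW_bij _ (@enum_val_bij I))).
Qed.

Lemma variation_ge0 mu B : (0 <= variation mu B)%E.
Proof.
have := @variation_ge mu B 'I_0 (fun=> set0); rewrite big_ord0; apply => //.
all: by move=> [].
Qed.

Lemma variation_mono mu B D : B `<=` D -> (variation mu B <= variation mu D)%E.
Proof.
move=> BD; apply: le_ereal_sup => _ [n [E [mE tE EB ->]]].
by exists n, E; split => // i; exact: subset_trans (EB i) BD.
Qed.

Lemma mass_mono mu B D : measurable B -> measurable D ->
  precompact (D : set G) -> B `<=` D -> mass mu B <= mass mu D.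
Proof.
move=> mB mD pD BD; have pB := precompact_subset BD pD.
have key m : fine (m B) <= fine (m D).
  by rewrite fine_le ?radon_fin_num// le_measure ?inE.
by rewrite !lerD.
Qed.

Lemma variation_mass mu B : measurable B -> precompact (B : set G) ->
  (variation mu B <= (2 * mass mu B)%:E)%E.
Proof.
move=> mB pB; apply: ge_ereal_sup => _ [n [E [mE tE EB ->]]].
have mE' i : measurable (E i) by have [] := mE i.
have UB : \big[setU/set0]_(i < n) E i `<=` B.
  by rewrite -bigcup_seq => x [i _ /EB].
have pU := precompact_subset UB pB.
rewrite lee_fin; apply: (@le_trans _ _ (2 * \sum_(i < n) mass mu (E i))).
  rewrite mulr_sumr; apply: ler_sum => i _; apply: normc_cval_mass => //.
  by have [] := mE i.
rewrite -mass_bigsetU// ler_pM2l// mass_mono//; exact: bigsetU_measurable.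
Qed.

(** An infinite variation is turned into 0 by [fine]; lemmas that compare values therefore carry a
    finiteness or precompactness hypothesis. *)
Definition tv mu B : R := fine (variation mu B).

Lemma tv_ge0 mu B : 0 <= tv mu B.
Proof. by rewrite fine_ge0// variation_ge0. Qed.

Lemma variation_fin mu B : measurable B -> precompact (B : set G) ->
  (variation mu B < +oo)%E.
Proof. by move=> mB pB; apply: le_lt_trans (variation_mass mu mB pB) (ltry _). Qed.

Lemma tvE mu B : (variation mu B < +oo)%E -> (tv mu B)%:E = variation mu B.
Proof. by move=> Bfin; rewrite fineK// ge0_fin_numE// variation_ge0. Qed.

Lemma tv_set0 mu : tv mu set0 = 0.
Proof.
have p0 : precompact (set0 : set G) by rewrite precompactE closure0; exact: compact0.
apply/eqP; rewrite eq_le tv_ge0 andbT -lee_fin tvE ?variation_fin//.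
by have := variation_mass mu measurable0 p0; rewrite /mass !measure0 !addr0 mulr0.
Qed.

Lemma le_tv mu B D : (variation mu D < +oo)%E -> B `<=` D -> tv mu B <= tv mu D.
Proof.
move=> Dfin BD; have le := variation_mono mu BD.
by rewrite -lee_fin !tvE// (le_lt_trans le).
Qed.

(** Test pieces in [B] and test pieces in [D] form together a disjoint family in [F]; the two
    suprema are then taken one after the other. *)
Lemma tvU mu B D F : (variation mu F < +oo)%E -> B `&` D = set0 ->
  B `<=` F -> D `<=` F -> tv mu B + tv mu D <= tv mu F.
Proof.
move=> Ffin BD0 BF DF.
have Bfin := le_lt_trans (variation_mono mu BF) Ffin.
have Dfin := le_lt_trans (variation_mono mu DF) Ffin.
rewrite -lerBrDr -lee_fin EFinB !tvE//.
apply: ge_ereal_sup => _ [n [E [mE tE EB ->]]].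
rewrite leeBrDr; last by rewrite ge0_fin_numE// variation_ge0.
rewrite addeC -leeBrDr//.
apply: ge_ereal_sup => _ [k [E' [mE' tE' EB' ->]]].
rewrite leeBrDr// -EFinD addrC.
pose H (x : 'I_n + 'I_k) := match x with inl i => E i | inr j => E' j end.
have -> : \sum_(i < n) normc (cval mu (E i)) + \sum_(i < k) normc (cval mu (E' i))
    = \sum_x normc (cval mu (H x)) by rewrite big_sumType.
apply: variation_ge.
- by case=> i; [have [] := mE i|have [] := mE' i].
- by case=> i; [have [] := mE i|have [] := mE' i].
- apply/trivIsetP => -[i|i] [j|j] _ _ ij.
  + by move/trivIsetP : tE; apply => //; apply: contra ij => /eqP ->.
  + by apply/seteqP; split => // x [/EB Bx /EB' Dx]; rewrite -BD0.
  + by apply/seteqP; split => // x [/EB' Bx /EB Dx]; rewrite -BD0.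
  + by move/trivIsetP : tE'; apply => //; apply: contra ij => /eqP ->.
- by case=> i x; [move=> /EB/BF|move=> /EB'/DF].
Qed.

Lemma tv_sum_le mu F n (E : 'I_n -> set (borel G)) (P : pred 'I_n) :
  (variation mu F < +oo)%E -> trivIset setT E ->
  (forall i, P i -> E i `<=` F) -> \sum_(i < n | P i) tv mu (E i) <= tv mu F.
Proof.
move=> Ffin tE EF.
(* Induction on a list of indices, where the union over the list takes the place of [F] so that
   [tvU] can split off one piece. *)
suff H (s : seq 'I_n) : uniq s -> (forall i, i \in s -> P i) ->
    \sum_(i <- s) tv mu (E i) <= tv mu (\bigcup_(i in [set` s]) E i).
  rewrite -big_filter; pose s := [seq i <- index_enum 'I_n | P i].
  apply: (@le_trans _ _ (tv mu (\bigcup_(i in [set` s]) E i))).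
    apply: H; first by rewrite filter_uniq// index_enum_uniq.
    by move=> i; rewrite mem_filter => /andP[].
  apply: le_tv => // x [i /=]; rewrite mem_filter => /andP[Pi _].
  exact: EF.
elim: s => [|i s ih] us sP; first by rewrite big_nil tv_ge0.
rewrite big_cons; move: us => /= /andP[iNs us].
apply: (@le_trans _ _ (tv mu (E i) + tv mu (\bigcup_(i in [set` s]) E i))).
  by rewrite lerD2l ih// => j js; rewrite sP// in_cons js orbT.
apply: tvU.
- apply: le_lt_trans Ffin; apply: variation_mono => x [j /= js]; apply: EF.
  exact: sP.
- apply/seteqP; split => // x [Eix [j /= js Ejx]].
  have ij : i != j by apply: contraNneq iNs => ->.
  have /trivIsetP/(_ i j Logic.I Logic.I ij) := tE.
  by rewrite -subset0 => /(_ x); exact.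
- by move=> x Eix; exists i => //=; rewrite in_cons eqxx.
- by move=> x [j /= js Ejx]; exists j => //=; rewrite in_cons js orbT.
Qed.

(** Each test piece [H j] of the union is cut along the [E i]. The triangle inequality bounds its
    contribution by those of the parts, and for fixed [i] these parts are test pieces of [E i]. *)
Lemma tv_le_sum mu n (E : 'I_n -> set (borel G)) :
  (forall i, measurable (E i)) -> trivIset setT E ->
  precompact (\big[setU/set0]_(i < n) E i : set G) ->
  tv mu (\big[setU/set0]_(i < n) E i) <= \sum_(i < n) tv mu (E i).
Proof.
move=> mE tE pE; have mB : measurable (\big[setU/set0]_(i < n) E i).
  exact: bigsetU_measurable.
have pEi i : precompact (E i : set G).
  by apply: precompact_subset pE; exact: sub_bigsetU.
rewrite -lee_fin tvE; last exact: variation_fin.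
apply: ge_ereal_sup => _ [k [H [mH tH HB ->]]]; rewrite lee_fin.
have HE j : H j = \big[setU/set0]_(i < n) (H j `&` E i).
  by rewrite -big_distrr/=; apply/esym/setIidPl; exact: HB.
have mHE j i : measurable (H j `&` E i).
  by apply: measurableI => //; have [] := mH j.
have pHE j i : precompact (H j `&` E i : set G).
  by apply: precompact_subset (pEi i); exact: subIsetr.
apply: (@le_trans _ _ (\sum_(j < k) \sum_(i < n) normc (cval mu (H j `&` E i)))).
  apply: ler_sum => j _; rewrite {1}HE cval_bigsetU//; first exact: normc_sum.
    apply/trivIsetP => a b _ _ ab; rewrite setIACA setIid.
    by have /trivIsetP -> // := tE; rewrite setI0.
  by rewrite -HE; have [] := mH j.
rewrite exchange_big; apply: ler_sum => i _.
rewrite -lee_fin tvE; last exact: variation_fin.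
apply: variation_ge => //.
  apply/trivIsetP => a b _ _ ab; rewrite setIACA setIid.
  by have /trivIsetP -> // := tH; rewrite set0I.
Qed.

(** On a fine partition [f] is nearly constant, so the integral is close to a sum of values of [f]
    times the [cval mu (E i)], which is at most [M] times the variation. The error
    [2 * d * mass mu B] stays below [e] by the choice of [d]. *)
Lemma cint_tv mu B f M : measurable B -> precompact (B : set G) ->
  Cu f -> 0 <= M -> (forall x, B x -> normc (f x) <= M) ->
  normc (cint mu B f) <= M * tv mu B.
Proof.
move=> mB pB Cf M0 fM; apply/ler_addgt0Pr => e e0.
have ms0 : 0 < 2 * mass mu B + 1 by rewrite ltr_pwDr// mulr_ge0 ?mass_ge0.
pose d := e / (2 * mass mu B + 1).
have d0 : 0 < d by rewrite divr_gt0.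
have d20 : 0 < d / 2 by rewrite divr_gt0.
have [_ /(_ _ d20) fU] := Cf.
have [n [t [E [mE tE EB EU]]]] := fine_partition fU mB pB.
have EsubB i : E i `<=` B by rewrite EB; exact: sub_bigsetU.
have pE i : precompact (E i : set G) by exact: precompact_subset (EsubB i) pB.
have Ei i : normc (cint mu (E i) f) <=
    M * normc (cval mu (E i)) + 2 * d * mass mu (E i).
  have cEi c : (forall x, E i x -> normc (f x - c) <= d) ->
      normc (cint mu (E i) f) <=
      normc c * normc (cval mu (E i)) + 2 * d * mass mu (E i).
    move=> fc; have -> : cint mu (E i) f =
        c * cval mu (E i) + cint mu (E i) (fun x => f x - c).
      by rewrite cintB ?cint_cst//; [rewrite addrC subrK|exact: Cu_cst].
    apply: le_trans (normcD _ _) _; rewrite normcM lerD2l.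
    by apply: cint_mass => //; apply: CuB => //; exact: Cu_cst.
  (* The comparison value is taken at a point [a] of the piece, since [M] bounds [f] only on [B] and
     the centre [t i] may lie outside; passing through [f (t i)] costs [d / 2] twice. An empty piece
     is compared with 0. *)
  have [E0|/set0P[a Ea]] := eqVneq (E i) set0.
    apply: le_trans (cEi 0 _) _; first by move=> x; rewrite E0.
    by rewrite normc0 mul0r lerD2r mulr_ge0// normc_ge0.
  apply: le_trans (cEi (f a) _) _ => [x Ex|].
    have := EU i x Ex; move=> /(_ (t i)); rewrite addrCA subrr addr0 => fx.
    have := EU i a Ea; move=> /(_ (t i)); rewrite addrCA subrr addr0 => fa.
    apply: le_trans (normc_triangle _ (f (t i)) _) _.
    by rewrite (splitr d) lerD// ltW// normc_distC.
  rewrite lerD2r ler_wpM2r ?normc_ge0//; apply: fM; exact: EsubB Ea.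
have mEs i : precompact (\big[setU/set0]_(i < n) E i : set G) by rewrite -EB.
rewrite {1}EB cint_bigsetU -?EB//.
apply: le_trans (normc_sum _ _) _.
apply: (@le_trans _ _ (\sum_(i < n) (M * normc (cval mu (E i)) +
    2 * d * mass mu (E i)))); first by apply: ler_sum => i _; exact: Ei.
rewrite big_split/= -!mulr_sumr -mass_bigsetU -?EB//; apply: lerD.
  rewrite ler_wpM2l// -lee_fin tvE; last exact: variation_fin.
  exact: variation_ge.
rewrite mulrAC /d mulrA ler_pdivrMr// mulrC ler_pM2l//.
by rewrite lerDl.
Qed.

End Variation.

(** * Comparison with Haar measure *)

Section Transfer.
Context {G : topologicalZmodType} {R : realType}.
Variable haar : radon G R.
Hypothesis haarH : is_haar haar.
Implicit Types (f : G -> R[i]) (mu : cradon G R) (B : set (borel G)).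

Lemma haar_shift (t : G) (U : set (borel G)) : measurable U ->
  haar [set x : G | U (x - t)] = haar U.
Proof. by move=> mU; have [_ /(_ t _ mU) <-] := haarH; rewrite image_addl. Qed.

Lemma measurable_subr (t : G) :
  measurable_fun [set: borel G] ((fun x : G => x - t) : borel G -> borel G).
Proof.
apply: (@measurability _ _ (borel G) (borel G) setT _ (@open G)) => //.
by move=> _ [V oV <-]; rewrite setTI; apply: open_measurable_borel;
  exact: (open_shift t oV).
Qed.

Lemma measurable_shift (t : G) (U : set (borel G)) : measurable U ->
  measurable ([set x : G | U (x - t)] : set (borel G)).
Proof.
by move=> mU; have := @measurable_subr t measurableT U mU; rewrite setTI.
Qed.

(** If [U] were null, so would be its translates, and finitely many of them cover [B]. *)
Lemma haar_gt0 (U : set G) B : nbhs (0 : G) U -> measurable (U : set (borel G)) ->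
  measurable B -> precompact (B : set G) -> (0 < haar B)%E -> (0 < haar U)%E.
Proof.
move=> U0 mU mB pB B0; have [n [t [E [mE tE EB EU]]]] := fine_partition U0 mB pB.
rewrite lt0e measure_ge0 andbT; apply/eqP => HU.
have : fine (haar B) = 0.
  rewrite EB fine_radon_bigsetU -?EB// big1// => i _.
  suff -> : haar (E i) = 0%E by [].
  apply/eqP; rewrite eq_le measure_ge0 andbT -HU -(haar_shift (t i) mU).
  by rewrite le_measure ?inE//; [exact: measurable_shift|exact: EU].
move=> /eqP; rewrite fine_eq0 ?radon_fin_num// => /eqP hB.
by rewrite hB ltxx in B0.
Qed.

Lemma translation_bounded_bound mu (K : set G) :
  translation_bounded mu -> compact K ->
  exists2 C : R, 0 <= C &
    forall t, (variation mu [set x : G | K (x - t)%R] <= C%:E)%E.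
Proof.
move=> tb /tb; set s := ereal_sup _ => sfin.
have vs t : (variation mu [set x : G | K (x - t)%R] <= s)%E.
  by apply: ereal_sup_ubound; exists t => //; rewrite image_addl.
have s0 : (0 <= s)%E by exact: le_trans (variation_ge0 _ _) (vs 0).
exists (fine s); first exact: fine_ge0.
by move=> t; rewrite fineK// ge0_fin_numE.
Qed.

(** The discrete substitute for exchanging an integral against [mu] with one against Haar measure.
    With [W i] the translate of [U] by [s + t i], the number [haar U * N i] is at most the integral
    of [g] over [W i]. At a fixed [y], the pieces whose [W i] contains [y] all lie in one translate
    of [V], so their variations add up to at most [D]. Hence [C] is [D / haar U] and depends only on
    [mu] and [U]. *)
Lemma tv_transfer mu (U : set (borel G)) : translation_bounded mu ->
  measurable U -> precompact (U : set G) -> (0 < haar U)%E ->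
  exists2 C : R, 0 <= C & forall n (t : 'I_n -> G) (E : 'I_n -> set (borel G))
      (N : 'I_n -> R) (s : G) (g : borel G -> R),
    trivIset setT E -> (forall i x, E i x -> U (x - t i)) ->
    (forall i, 0 <= N i) -> measurable_fun setT g -> (forall y, 0 <= g y) ->
    (forall i y, U (y - s - t i) -> N i <= g y) ->
    ((\sum_(i < n) N i * tv mu (E i))%:E <= C%:E * \int[haar]_y (g y)%:E)%E.
Proof.
move=> tb mU pU U0; pose V := minkowski_diff (closure (U : set G)) (closure (U : set G)).
have cV : compact V.
  by apply: compact_minkowski_diff; rewrite -precompactE.
have [D D0 VD] := translation_bounded_bound tb cV.
have Ufin := radon_fin_num haar mU pU.
have hU0 : 0 < fine (haar U) by rewrite fine_gt0// U0 radon_precompact.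
exists (D / fine (haar U)); first by rewrite divr_ge0// ltW.
move=> n t E N s g tE EU N0 mg g0 Ng.
pose W i : set (borel G) := [set y : G | U (y - (s + t i))].
have mW i : measurable (W i) by exact: measurable_shift.
have UW i y : W i y -> U (y - s - t i) by rewrite /W/= opprD addrA.
have mgW i : measurable_fun setT (g \_ (W i)).
  by apply/(measurable_restrictT _ _).1 => //; exact: measurable_funTS.
have gW0 i y : 0 <= (g \_ (W i)) y by rewrite patchE; case: ifPn.
suff H : ((fine (haar U) * \sum_(i < n) N i * tv mu (E i))%:E <=
    D%:E * \int[haar]_y (g y)%:E)%E.
  rewrite -(@lee_pmul2l _ (fine (haar U))%:E) ?lte_fin// -EFinM muleA -EFinM.
  by rewrite (mulrC D) mulVKf// gt_eqF.
rewrite mulr_sumr -sumEFin.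
(* The constant [N i] integrated over [W i] gives [N i * haar U], and it is at most [g] there. *)
apply: (@le_trans _ _ (\sum_(i < n) (tv mu (E i))%:E *
    \int[haar]_y ((g \_ (W i)) y)%:E)%E).
  apply: lee_sum => i _.
  have -> : (fine (haar U) * (N i * tv mu (E i)))%:E =
      ((tv mu (E i))%:E * \int[haar]_(y in W i) (N i)%:E)%E.
    rewrite integral_cst//= haar_shift// -[in RHS](fineK Ufin) -!EFinM.
    by congr EFin; ring.
  rewrite lee_wpmul2l ?lee_fin ?tv_ge0//.
  have -> : (\int[haar]_y ((g \_ (W i)) y)%:E = \int[haar]_(y in W i) (g y)%:E)%E.
    by rewrite [RHS]integral_mkcond; apply: eq_integral => y _; rewrite !patchE; case: ifP.
  apply: ge0_le_integral => //.
  - by move=> y _; rewrite lee_fin.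
  - by apply/measurable_EFinP; exact: measurable_funTS.
  - by move=> y Wy; rewrite lee_fin Ng//; exact: UW.
under eq_bigr => i _.
  rewrite -ge0_integralZl//; [|by apply/measurable_EFinP| |]; last 2 first.
  - by move=> y _; rewrite lee_fin.
  - by rewrite lee_fin tv_ge0.
  over.
rewrite -ge0_integral_sum//; last 2 first.
- by move=> i; apply: measurable_funeM; apply/measurable_EFinP.
- by move=> i y _; rewrite mule_ge0// lee_fin// tv_ge0.
rewrite -ge0_integralZl//; last 2 first.
- by apply/measurable_EFinP.
- by move=> y _; rewrite lee_fin.
apply: ge0_le_integral => //.
- by move=> y _; apply: sume_ge0 => i _; rewrite mule_ge0// lee_fin// tv_ge0.
- by apply: emeasurable_sum => i; apply: measurable_funeM; apply/measurable_EFinP.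
- by apply: measurable_funeM; apply/measurable_EFinP.
move=> y _; rewrite -EFinM; under eq_bigr do rewrite -EFinM.
(* Only indices with [y] in [W i] contribute. For these, [x] in [E i] gives [x - (y - s)] as the
   difference of [x - t i] and [y - s - t i], both in [U]. *)
rewrite sumEFin lee_fin (bigID (fun i => y \in W i))/= [X in _ + X]big1 ?addr0; last first.
  by move=> i yW; rewrite patchE (negbTE yW) mulr0.
under eq_bigr => i yW do rewrite patchE yW.
rewrite -mulr_suml ler_wpM2r//.
have vfin : (variation mu [set x : G | V (x - (y - s))%R] < +oo)%E.
  exact: le_lt_trans (VD _) (ltry _).
apply: (@le_trans _ _ (tv mu [set x : G | V (x - (y - s))])).
  apply: tv_sum_le => // i /set_mem/UW Uy x /EU Ux.
  exists (x - t i); first exact: subset_closure.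
  exists (y - s - t i); first exact: subset_closure.
  by rewrite opprB addrA subrK.
by rewrite -lee_fin tvE.
Qed.

Lemma tv_le_integral mu (U : set (borel G)) : translation_bounded mu ->
  nbhs (0 : G) U ->
  measurable U -> precompact (U : set G) -> (0 < haar U)%E ->
  exists2 C : R, 0 <= C & forall B (g : borel G -> R),
    measurable B -> precompact (B : set G) ->
    measurable_fun setT g -> (forall y, 0 <= g y) ->
    (forall b a y, B b -> U (b - a) -> U (y - a) -> 1 <= g y) ->
    ((tv mu B)%:E <= C%:E * \int[haar]_y (g y)%:E)%E.
Proof.
move=> tb nU mU pU U0; have [C C0 HC] := tv_transfer tb mU pU U0.
exists C => // B g mB pB mg g0 gB.
have [n [t [E [mE tE EB EU]]]] := fine_partition nU mB pB.
have EsubB i : E i `<=` B by rewrite EB; exact: sub_bigsetU.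
(* Weight 1 recovers the variation of [B]; an empty piece gets weight 0 because the hypothesis on
   [g] says nothing around its centre. *)
pose N i : R := (E i != set0)%:R.
apply: le_trans (HC n t E N 0 g tE EU _ mg g0 _).
- rewrite lee_fin {1}EB; apply: le_trans (tv_le_sum mu mE tE _) _.
    by rewrite -EB.
  apply: ler_sum => i _; rewrite /N; case: eqVneq => [->|_]; last by rewrite mul1r.
  by rewrite mul0r tv_set0.
- by move=> i; rewrite /N.
- move=> i y; rewrite subr0 => Uy; rewrite /N; case: eqVneq => [//|/set0P[b Eb]].
  exact: (gB b (t i) y (EsubB i b Eb) (EU i b Eb) Uy).
Qed.

(** The oscillation [e] is kept apart from [g]: it is paired with the variation of [B], while only
    the integral of [g] is multiplied by the constant that depends on [U]. *)
Lemma cint_le_integral mu (U : set (borel G)) : translation_bounded mu ->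
  nbhs (0 : G) U ->
  measurable U -> precompact (U : set G) -> (0 < haar U)%E ->
  exists2 C : R, 0 <= C & forall B f (s : G) (e : R) (g : borel G -> R),
    measurable B -> precompact (B : set G) -> Cu f -> 0 <= e ->
    measurable_fun setT g -> (forall y, 0 <= g y) ->
    (forall b a y, B b -> U (b - a) -> U (y - s - a) -> normc (f b) <= e + g y) ->
    ((normc (cint mu B f))%:E <=
     (e * tv mu B)%:E + C%:E * \int[haar]_y (g y)%:E)%E.
Proof.
move=> tb nU mU pU U0; have [C C0 HC] := tv_transfer tb mU pU U0.
exists C => // B f s e g mB pB Cf e0 mg g0 fg.
have [n [t [E [mE tE EB EU]]]] := fine_partition nU mB pB.
have EsubB i : E i `<=` B by rewrite EB; exact: sub_bigsetU.
have pE i : precompact (E i : set G) by exact: precompact_subset (EsubB i) pB.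
(* The infimum [N i] of these values lies below [g] on the translate of [U] by [s + t i]; since
   [e + g y] bounds [f] on [E i] for every such [y], so does [e + N i]. *)
pose S i := [set g y | y in [set y : G | U (y - s - t i)]].
have S0 i : S i !=set0.
  exists (g (s + t i)), (s + t i) => //=.
  by rewrite (addrC s) addrK subrr; exact: nbhs_singleton.
have Slb i : lbound (S i) 0 by move=> _ [y _ <-].
pose N i : R := inf (S i).
have N0 i : 0 <= N i by apply: lb_le_inf.
have Ng i y : U (y - s - t i) -> N i <= g y.
  by move=> Uy; apply: ge_inf; [exists 0; exact: Slb|exists y].
have fN i x : E i x -> normc (f x) <= e + N i.
  move=> Ex; rewrite -lerBlDl; apply: lb_le_inf => // _ [y Uy <-].
  by rewrite lerBlDl; exact: (fg x (t i) y (EsubB i x Ex) (EU i x Ex) Uy).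
apply: (@le_trans _ _ ((e * tv mu B)%:E + (\sum_(i < n) N i * tv mu (E i))%:E)%E).
  rewrite -EFinD lee_fin {1}EB cint_bigsetU//; last by rewrite -EB.
  apply: le_trans (normc_sum _ _) _.
  apply: (@le_trans _ _ (\sum_(i < n) (e * tv mu (E i) + N i * tv mu (E i)))).
    apply: ler_sum => i _; rewrite -mulrDl; apply: cint_tv => //.
      by rewrite addr_ge0.
    exact: fN.
  rewrite big_split lerD2r -mulr_sumr ler_wpM2l//.
  by apply: tv_sum_le => //; exact: variation_fin.
by rewrite leeD2l//; exact: (HC n t E N s g).
Qed.


End Transfer.

(** * Convolution with compactly supported functions *)

Section CompactSupport.
Context {G : topologicalZmodType} {R : realType}.
Hypothesis hausG : hausdorff_space G.
Implicit Types (f phi : G -> R[i]) (mu : cradon G R) (B : set (borel G)).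

Lemma continuous_normc f : continuous f -> continuous (fun x => normc (f x)).
Proof.
move=> cf x; apply/cvgrPdist_lt => e e0.
have /cvgrPdist_lt/(_ e%:C) := cf x; rewrite ltcR => /(_ e0).
apply: filterS => y; rewrite -normc_norm ltcR; apply: le_lt_trans.
rewrite ler_norml lerNl opprB normc_ler_sub andbT normc_distC.
exact: normc_ler_sub.
Qed.

Lemma measurable_normc f : continuous f ->
  measurable_fun [set: borel G] (fun x : borel G => normc (f x)).
Proof. by move=> /continuous_normc; exact: measurable_continuous_borel. Qed.

Lemma compact_measurable_borel (K : set G) :
  compact K -> measurable (K : set (borel G)).
Proof. by move=> cK; apply: closed_measurable_borel; exact: compact_closed. Qed.

Lemma compact_precompact (K : set G) : compact K -> precompact K.
Proof. by move=> cK; rewrite precompact_closed//; exact: compact_closed. Qed.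

Lemma Cc_compact phi (K : set G) : continuous phi -> compact K ->
  (forall x, ~ K x -> phi x = 0) -> Cc phi.
Proof.
move=> cphi cK phi0; split => //.
apply: (subclosed_compact _ cK); first exact: closed_closure.
rewrite [X in _ `<=` X](closure_id K).1; last exact: compact_closed.
by apply: closure_subset => x /= /eqP; apply: contra_notP => /phi0.
Qed.

Lemma Cc_support phi : Cc phi ->
  exists2 K : set G, compact K & forall x, ~ K x -> phi x = 0.
Proof.
move=> [_ cK]; exists (closure [set x | phi x != 0]) => // x.
by apply: contra_notP => /eqP phix; exact: subset_closure.
Qed.

Lemma Cc_Cu phi : Cc phi -> Cu phi.
Proof.
move=> Cphi; have [cphi _] := Cphi; have [K cK K0] := Cc_support Cphi; split.
  have := compact_bounded (continuous_compact
    (continuous_subspaceT (continuous_normc cphi)) cK).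
  move=> [M [_ /(_ (`|M| + 1))]]; rewrite ltr_pwDr ?ler_norm// => /(_ erefl) h.
  exists (`|M| + 1) => x; have [Kx|/K0 ->] := pselect (K x); last by rewrite normc0.
  by have := h _ (ex_intro2 _ _ x Kx erefl); apply: le_trans; exact: ler_norm.
move=> e e0.
have H : \forall u \near (0 : G), K `<=` (fun x => normc (phi (x + u) - phi x) < e).
  apply: (proj1 (compact_near_coveringP K) cK) => x Kx.
  have e20 : 0 < e / 2 by rewrite divr_gt0.
  have near_e y : y = x -> \forall z \near (y : G), normc (phi z - phi x) < e / 2.
    move=> ->; have /cvgrPdist_lt/(_ (e / 2)%:C) := cphi x.
    rewrite ltcR => /(_ e20); apply: filterS => z.
    by rewrite -normc_norm ltcR normc_distC.
  have h1 : \forall yu \near ((x, 0) : G * G), normc (phi (yu.1 + yu.2) - phi x) < e / 2.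
    have := near_e _ (addr0 x); exact: (@add_continuous G (x, 0)).
  have h2 : \forall yu \near ((x, 0) : G * G), normc (phi yu.1 - phi x) < e / 2.
    have := near_e x erefl; exact: cvg_fst.
  apply: filterS2 h1 h2 => -[y u] /= hu hy.
  rewrite (le_lt_trans (normc_triangle _ (phi x) _))// (splitr e) ltrD//.
  by rewrite normc_distC.
(* When only [x + u] lies in [K], the estimate is applied at [x + u] with increment [- u]; when
   neither point does, both values vanish. *)
apply: filterS2 H (nbhs0N H) => u Hu HNu x.
have [Kx|nKx] := pselect (K x); first exact: Hu.
have [Kxu|nKxu] := pselect (K (x + u)).
  by have := HNu _ Kxu; rewrite addrK normc_distC.
by rewrite !K0// subrr normc0.
Qed.

Lemma Cc_star phi : Cc phi -> Cc (star phi).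
Proof.
move=> Cphi; have [K cK K0] := Cc_support Cphi.
apply: (@Cc_compact _ (-%R @^-1` K)).
- by apply: Cu_continuous; apply: Cu_star; exact: Cc_Cu.
- exact: compact_opp.
- by move=> x nKx; rewrite /star K0// rmorph0.
Qed.

Lemma Cc_conj phi : Cc phi -> Cc (fun x => conjc (phi x)).
Proof.
move=> Cphi; have [K cK K0] := Cc_support Cphi.
apply: (@Cc_compact _ K) => //; first exact/Cu_continuous/Cu_conj/Cc_Cu.
by move=> x nKx; rewrite K0// rmorph0.
Qed.

Lemma Cc_reflect (t : G) phi : Cc phi -> Cc (fun s => phi (t - s)).
Proof.
move=> Cphi; have [K cK K0] := Cc_support Cphi.
apply: (@Cc_compact _ (minkowski_diff [set t] K)).
- apply: Cu_continuous; have := Cu_opp (Cu_shift t (Cc_Cu Cphi)).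
  by [].
- by apply: compact_minkowski_diff => //; exact: compact_set1.
- move=> x nKx; apply: K0 => Kx; apply: nKx; exists t => //.
  by exists (t - x) => //; rewrite opprB addrC subrK.
Qed.

Definition conv_on mu B phi : G -> R[i] :=
  fun x => cint mu B (fun s => phi (x - s)).

Lemma Cu_reflect (x : G) phi : Cu phi -> Cu (fun s => phi (x - s)).
Proof. by move=> /(Cu_shift x)/Cu_opp. Qed.

(** Both integrals live on the part of [B] inside the translate of [K] by [x], whose variation is
    bounded uniformly in [x] by translation boundedness. So [B] may be the whole group. *)
Lemma cint_supported_bound mu (K : set G) :
  translation_bounded mu -> compact K ->
  exists2 C : R, 0 <= C & forall B f g (x : G) (M : R),
    measurable B -> Cu f -> Cu g -> 0 <= M ->
    (forall s, ~ K (s - x) -> f s = 0) -> (forall s, ~ K (s - x) -> g s = 0) ->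
    (forall s, normc (f s - g s) <= M) ->
    normc (cint mu B f - cint mu B g) <= M * C.
Proof.
move=> tb cK; have [C C0 KC] := translation_bounded_bound tb cK.
exists C => // B f g x M mB Cf Cg M0 f0 g0 fg.
pose D : set (borel G) := B `&` [set s : G | K (s - x)].
have cKx : compact [set s : G | K (s - x)] by rewrite -image_addl; exact: compact_shift.
have mD : measurable D by apply: measurableI => //; exact: compact_measurable_borel.
have pD : precompact (D : set G).
  by apply: precompact_subset (compact_precompact cKx); exact: subIsetr.
have DB : D `<=` B by exact: subIsetl.
rewrite (@cint_supported _ _ _ D)//; last by move=> s Bs nD; apply: f0 => Ks; exact: nD.
rewrite (@cint_supported _ _ _ D)//; last by move=> s Bs nD; apply: g0 => Ks; exact: nD.
rewrite -cintB//; apply: le_trans (cint_tv mu mD pD (CuB Cf Cg) M0 _) _ => //.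
rewrite ler_wpM2l// -lee_fin tvE; last exact: variation_fin.
by apply: le_trans (KC x); apply: variation_mono; exact: subIsetr.
Qed.

Lemma conv_on_bound mu phi : translation_bounded mu -> Cc phi ->
  exists2 M : R, 0 <= M &
    forall B x, measurable B -> normc (conv_on mu B phi x) <= M.
Proof.
move=> tb Cphi; have [K cK K0] := Cc_support Cphi.
have [[N phiN] _] := Cc_Cu Cphi.
have N0 : 0 <= N by exact: le_trans (normc_ge0 _) (phiN 0).
have [C C0 H] := cint_supported_bound tb (compact_opp cK).
exists (N * C); first exact: mulr_ge0.
move=> B x mB; have c0 : cint mu B (fun=> 0) = 0 by rewrite cint_cst ?mul0r.
rewrite -[conv_on _ _ _ _]subr0 -c0; apply: (H _ _ _ x) => //.
- exact/Cu_reflect/Cc_Cu.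
- exact: Cu_cst.
- by move=> s /=; rewrite opprB => /K0.
- by move=> s; rewrite subr0.
Qed.

Hypothesis lcG : locally_compact [set: G].

Lemma precompact_nbhs0 :
  exists2 U : set G, open_nbhs (0 : G) U & precompact U.
Proof.
have [U] := lcG (Logic.I : [set: G] 0).
rewrite /within /= => U0' cU.
have U0 : nbhs (0 : G) U by apply: filterS U0' => x; exact.
exists (interior U); last by exists U => //; exact: interior_subset.
by split; [exact: open_interior|exact: nbhs_singleton (nbhs_interior U0)].
Qed.

Lemma Cu_conv_on mu B phi : translation_bounded mu -> measurable B -> Cc phi ->
  Cu (conv_on mu B phi).
Proof.
move=> tb mB Cphi; split.
  by have [M M0 HM] := conv_on_bound tb Cphi; exists M => x; exact: HM.
move=> e e0; have [K cK K0] := Cc_support Cphi.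
have [U [oU U0] pU] := precompact_nbhs0.
(* If [x + u - s] lies in [K] with [u] in [U], then [s - x] lies in [L]; the case [u = 0] covers the
   unshifted function, so both integrands are supported in the same translate. *)
pose L := minkowski_diff (closure U) K.
have cL : compact L by apply: compact_minkowski_diff => //; rewrite -precompactE.
have [C C0 H] := cint_supported_bound tb cL.
have C10 : 0 < C + 1 by rewrite ltr_pwDr.
have [_ /(_ (e / (C + 1)))] := Cc_Cu Cphi; rewrite divr_gt0// => /(_ erefl) phiu.
apply: filterS2 phiu (open_nbhs_nbhs (conj oU U0)) => u phiu Uu x.
apply: (@le_lt_trans _ _ (e / (C + 1) * C)); last first.
  by rewrite -mulrA gtr_pMr// mulrC ltr_pdivrMr// mul1r ltrDl.
have Cphi' := Cc_Cu Cphi.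
apply: (H B _ _ x) => //.
- exact: Cu_reflect.
- exact: Cu_reflect.
- by rewrite ltW// divr_gt0.
- move=> s nL; apply: K0 => Kxus; apply: nL; exists u; first exact: subset_closure.
  exists (x + u - s) => //.
  by rewrite opprB addrA [u + s]addrC opprD addrACA subrr addr0.
- move=> s nL; apply: K0 => Kxus; apply: nL; exists 0; first exact: subset_closure.
  by exists (x - s) => //; rewrite sub0r opprB.
- by move=> s; rewrite addrAC ltW.
Qed.

End CompactSupport.

(** * Integrals against the reflected measure *)

Section Reflection.
Context {G : topologicalZmodType} {R : realType}.
Implicit Types (f : G -> R[i]) (m : radon G R) (nu : cradon G R).
Implicit Type B : set (borel G).

Lemma Rintegral_reflection_on m B (f : G -> R) : measurable B -> continuous f ->
  (\int[radon_reflection m]_(x in ([set - x | x in B] : set (borel G))) f x)%R =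
  (\int[m]_(x in B) f (- x))%R.
Proof.
move=> mB /measurable_continuous_borel mf; rewrite image_oppr /Rintegral.
congr fine.
pose NB : set (borel G) := [set x : G | B (- x)].
have mNB : measurable NB.
  by have := @measurable_opp_borel G measurableT _ mB; rewrite setTI.
have mEf : measurable_fun NB (EFin \o (f : borel G -> R)).
  by apply/measurable_EFinP; exact: measurable_funTS.
have NBB : -%R @^-1` NB = B.
  by apply/seteqP; split => x; rewrite /NB /= opprK.
rewrite integralE [RHS]integralE; congr (_ - _)%E.
- rewrite [LHS](ge0_integral_pushforward (@measurable_opp_borel G))//.
    by rewrite NBB; apply: eq_integral => x _; rewrite -funepos_comp.
  exact: (measurable_funepos mEf).
- rewrite [LHS](ge0_integral_pushforward (@measurable_opp_borel G))//.
    by rewrite NBB; apply: eq_integral => x _; rewrite -funeneg_comp.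
  exact: (measurable_funeneg mEf).
Qed.

Lemma RintegralN_on m B (f : G -> R) :
  m.-integrable B (EFin \o (f : borel G -> R)) -> measurable B ->
  (\int[m]_(x in B) (- f x))%R = - (\int[m]_(x in B) f x)%R.
Proof.
move=> intf mB; rewrite -mulN1r -RintegralZl//.
by apply: eq_Rintegral => x _; rewrite mulN1r.
Qed.

Lemma cint_cstar nu B f : measurable B -> precompact (B : set G) -> Cu f ->
  cint (cstar nu) [set - x | x in B] f = conjc (cint nu B (star f)).
Proof.
move=> mB pB Cf; have cf := Cu_continuous Cf.
have key (m : radon G R) : cintegral (radon_reflection m) [set - x | x in B] f =
    conjc (cintegral m B (star f)).
  have [Ire Iim] := Cu_integrable m mB pB (Cu_star Cf).
  rewrite /cintegral /conjc; congr Complex.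
    rewrite Rintegral_reflection_on//; last exact: continuous_Re.
    by apply: eq_Rintegral => x _; rewrite /star; case: (f (- x)).
  rewrite Rintegral_reflection_on//; last exact: continuous_Im.
  rewrite -RintegralN_on//.
  by apply: eq_Rintegral => x _; rewrite /star; case: (f (- x)) => a b /=;
    rewrite opprK.
rewrite /cint /= !key.
by rewrite /cintegral /conjc; simpc; congr Complex; ring.
Qed.

End Reflection.

(** * Exchanging the two measures *)

Section Swap.
Context {G : topologicalZmodType} {R : realType}.
Hypothesis hausG : hausdorff_space G.
Hypothesis lcG : locally_compact [set: G].
Implicit Types (f phi : G -> R[i]) (mu nu : cradon G R) (B : set (borel G)).

Lemma cint_riemann mu n (t : 'I_n -> G) (E : 'I_n -> set (borel G)) f (d : R) :
  (forall i, measurable (E i)) -> trivIset setT E ->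
  precompact (\big[setU/set0]_(i < n) E i : set G) -> Cu f -> 0 <= d ->
  (forall i x, E i x -> normc (f x - f (t i)) <= d) ->
  normc (cint mu (\big[setU/set0]_(i < n) E i) f -
         \sum_(i < n) f (t i) * cval mu (E i)) <=
  2 * d * mass mu (\big[setU/set0]_(i < n) E i).
Proof.
move=> mE tE pE Cf d0 fd.
have pEi i : precompact (E i : set G).
  by apply: precompact_subset pE; exact: sub_bigsetU.
rewrite cint_bigsetU// -sumrB mass_bigsetU// mulr_sumr.
apply: le_trans (normc_sum _ _) _; apply: ler_sum => i _.
rewrite -cint_cst// -cintB//; last exact: Cu_cst.
by apply: cint_mass => //; [apply: CuB => //; exact: Cu_cst|exact: fd].
Qed.

(* Sesquilinear in the measures, which makes the swap below symmetric. *)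
Definition twisted_conv mu nu B phi : R[i] :=
  cint mu B (fun s => conjc (cint nu B (fun r => conjc (phi (s - r))))).

(** The inner integral [g] varies by at most [2 * d * mass nu B] on a piece, and its own Riemann sum
    has an error of the same size. The outer Riemann sum multiplies the first by [2 * mass mu B],
    the bound on the [cval mu (E i)] does so with the second, and [4 + 4 = 8]. *)
Lemma twisted_conv_riemann mu nu n (t : 'I_n -> G) (E : 'I_n -> set (borel G))
    phi (d : R) B :
  B = \big[setU/set0]_(i < n) E i -> translation_bounded nu ->
  (forall i, measurable (E i)) -> trivIset setT E ->
  precompact (B : set G) -> Cc phi -> 0 <= d ->
  (forall i x, E i x -> forall y, normc (phi (y + (x - t i)) - phi y) <= d) ->
  normc (twisted_conv mu nu B phi -
    \sum_(i < n) \sum_(j < n)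
      phi (t i - t j) * conjc (cval nu (E j)) * cval mu (E i)) <=
  8 * d * mass nu B * mass mu B.
Proof.
move=> BE tb mE tE pE Cphi d0 phid.
have mB : measurable B by rewrite BE; exact: bigsetU_measurable.
have pU : precompact (\big[setU/set0]_(i < n) E i : set G) by rewrite -BE.
have Cphi' := Cc_Cu Cphi.
pose g s := conjc (cint nu B (fun r => conjc (phi (s - r)))).
have Cr s : Cu (fun r => conjc (phi (s - r))).
  exact: (Cu_conj (Cu_reflect s Cphi')).
have Cg : Cu g.
  apply: Cu_conj; apply: (@Cu_conv_on _ _ hausG lcG nu B (fun x => conjc (phi x))) => //.
  exact: Cc_conj.
have gd i x : E i x -> normc (g x - g (t i)) <= 2 * d * mass nu B.
  move=> Ex; rewrite -rmorphB normcJ -cintB//.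
  apply: cint_mass => //; first by apply: CuB.
  move=> r _; rewrite -rmorphB normcJ.
  by have := phid i x Ex (t i - r); rewrite addrAC addrCA subrr addr0.
have gt i : normc (g (t i) - \sum_(j < n) phi (t i - t j) * conjc (cval nu (E j)))
    <= 2 * d * mass nu B.
  have -> : \sum_(j < n) phi (t i - t j) * conjc (cval nu (E j)) =
      conjc (\sum_(j < n) conjc (phi (t i - t j)) * cval nu (E j)).
    by rewrite rmorph_sum; apply: eq_bigr => j _; rewrite rmorphM/= conjcK.
  rewrite -rmorphB normcJ.
  rewrite BE; apply: (@cint_riemann nu n t E (fun r => conjc (phi (t i - r)))) => //.
  move=> j x Ex; rewrite -rmorphB normcJ normc_distC.
  have := phid j x Ex (t i - x); rewrite addrA subrK.
  by [].
have dn0 : 0 <= 2 * d * mass nu B by rewrite !mulr_ge0// mass_ge0.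
apply: le_trans (normc_triangle _ (\sum_(i < n) g (t i) * cval mu (E i)) _) _.
rewrite (_ : 8 * _ * _ * _ = 2 * (2 * d * mass nu B) * mass mu B +
   2 * d * mass nu B * (2 * mass mu B)); last by ring.
apply: lerD.
  by rewrite /twisted_conv -/g BE; apply: cint_riemann => //; rewrite -BE.
rewrite -sumrB; apply: le_trans (normc_sum _ _) _.
rewrite [in X in _ <= X]BE (mass_bigsetU mu)// -BE !mulr_sumr; apply: ler_sum => i _.
rewrite -mulr_suml -mulrBl normcM ler_pM ?normc_ge0//.
apply: normc_cval_mass => //.
by apply: precompact_subset pU; exact: sub_bigsetU.
Qed.

(** Over a common partition the double Riemann sums of the two sides coincide exactly after
    exchanging two finite sums, because [star phi (t j - t i)] is the conjugate of
    [phi (t i - t j)]. *)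
Lemma twisted_convC mu nu B phi : translation_bounded mu ->
  translation_bounded nu -> measurable B -> precompact (B : set G) -> Cc phi ->
  twisted_conv mu nu B phi = conjc (twisted_conv nu mu B (star phi)).
Proof.
move=> mutb nutb mB pB Cphi; apply/eqP; rewrite -subr_eq0; apply/eqP.
apply: eq0_normc; apply/eqP; rewrite eq_le normc_ge0 andbT.
apply/ler_addgt0Pr => e e0; rewrite add0r.
(* Each of the two Riemann approximations contributes 8; the added 1 keeps [c] positive when a mass
   vanishes. *)
pose c := 16 * mass mu B * mass nu B + 1.
have c0 : 0 < c by rewrite ltr_pwDr// !mulr_ge0// mass_ge0.
have d0 : 0 < e / c by rewrite divr_gt0.
have [_ /(_ _ d0) phiu] := Cc_Cu Cphi.
have [n [t [E [mE tE BE EU]]]] := fine_partition phiu mB pB.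
have dist i x : E i x -> forall y, normc (phi (y + (x - t i)) - phi y) <= e / c.
  by move=> Ex y; apply: ltW; exact: EU.
have distN i x : E i x ->
    forall y, normc (star phi (y + (x - t i)) - star phi y) <= e / c.
  move=> Ex y; rewrite /star -rmorphB normcJ normc_distC.
  by have := dist i x Ex (- (y + (x - t i))); rewrite {1}opprD subrK.
have := twisted_conv_riemann mu BE nutb mE tE pB Cphi (ltW d0) dist.
have := twisted_conv_riemann nu BE mutb mE tE pB (Cc_star hausG Cphi) (ltW d0) distN.
set S1 := \sum_(i < n) _; set S2 := \sum_(i < n) _.
have -> : S1 = conjc S2.
  rewrite /S1 /S2 rmorph_sum exchange_big; apply: eq_bigr => i _.
  rewrite rmorph_sum; apply: eq_bigr => j _.
  transitivity (conjc (phi (t i - t j)) * conjc (conjc (cval nu (E j))) *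
    conjc (cval mu (E i))); last by rewrite -!rmorphM.
  by rewrite conjcK /star opprB mulrAC.
move=> h1 h2; set T := twisted_conv nu mu B (star phi) in h1 *.
have ET : conjc (T - conjc S2) = conjc T - S2.
  by rewrite rmorphB; congr (_ - _); exact: conjcK.
apply: le_trans (normc_triangle _ S2 _) _.
apply: (@le_trans _ _ (16 * mass mu B * mass nu B * (e / c))); last first.
  by rewrite mulrCA ger_pMr// ler_pdivrMr// mul1r lerDl.
rewrite (_ : 16 * _ * _ * _ = 8 * (e / c) * mass nu B * mass mu B +
  8 * (e / c) * mass mu B * mass nu B); last by ring.
by apply: lerD => //; rewrite normc_distC -ET normcJ.
Qed.

End Swap.

(** * Averages along a van Hove sequence *)

(** Two points of the same translate of [U] differ by an element of [U - U]; this form feeds that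
    difference to [bd_out] and [bd_in]. *)
Lemma sub_decomp (V : zmodType) (a b y : V) : y = b + ((y - a) - (b - a)).
Proof. by rewrite opprB subrKA addrCA subrr addr0. Qed.

(** Tolerances are divided by [c + 1] below, so that a vanishing constant [c] needs no separate
    case. *)
Lemma mulr_div_le (R : realFieldType) (c e : R) : 0 <= c -> 0 <= e ->
  c * (e / (c + 1)) <= e.
Proof.
move=> c0 e0; rewrite mulrCA ler_piMr// ler_pdivrMr ?mul1r ?lerDl//.
by rewrite ltr_wpDl.
Qed.

Section VanHove.
Context {G : topologicalZmodType} {R : realType}.
Hypothesis hausG : hausdorff_space G.
Hypothesis lcG : locally_compact [set: G].
Variables (haar : radon G R) (A : nat -> set G).
Hypothesis haarH : is_haar haar.
Hypothesis vanHoveA : van_hove haar A.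
Implicit Types (f h q : G -> R[i]) (mu : cradon G R) (K : set G).

Let oA n : open (A n). Proof. by have [+ _ _ _] := vanHoveA; exact. Qed.
Let pA n : precompact (A n). Proof. by have [_ + _ _] := vanHoveA; exact. Qed.
Let mA n : measurable (A n : set (borel G)).
Proof. exact: open_measurable_borel. Qed.

Definition vol n : R := fine (haar (A n)).

Lemma volE n : (vol n)%:E = haar (A n).
Proof. by rewrite /vol fineK// radon_fin_num. Qed.

Lemma vol_gt0 n : 0 < vol n.
Proof. by rewrite -lte_fin volE; have [_ _ + _] := vanHoveA; exact. Qed.

Lemma haar_nbhs0_gt0 (U : set G) : nbhs (0 : G) U ->
  measurable (U : set (borel G)) -> (0 < haar U)%E.
Proof.
move=> nU mU; apply: (haar_gt0 haarH nU mU (mA 0) (pA 0)).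
by rewrite -volE lte_fin vol_gt0.
Qed.

Definition bd K n : set (borel G) := van_hove_boundary K (A n).

Lemma measurable_bd K n : compact K -> measurable (bd K n).
Proof.
move=> cK; apply: measurableU.
  by apply: measurableD => //; apply: closed_measurable_borel; exact: closed_closure.
apply: measurableI; apply: closed_measurable_borel; last exact: closed_closure.
by apply: closed_minkowski_diff => //; exact: open_closedC.
Qed.

Lemma bd_out K n x k : A n x -> K k -> A n (x + k) \/ bd K n (x + k).
Proof.
move=> Ax Kk; have [Axk|nAxk] := pselect (A n (x + k)); [by left|right; left].
by split => //; apply: subset_closure; exists x => //; exists k.
Qed.

Lemma bd_in K n x k : ~ A n x -> K k -> A n (x - k) -> bd K n (x - k).
Proof.
move=> nAx Kk Axk; right; split; last exact: subset_closure.
by exists x => //; exists k.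
Qed.

Lemma bd_small K (e : R) : compact K -> 0 < e ->
  \forall n \near \oo, (haar (bd K n) <= (e * vol n)%:E)%E.
Proof.
move=> cK e0; have [_ _ _ /(_ K cK)] := vanHoveA.
move=> /(_ [set y | y < e%:E]%E) /=.
have : nbhs (0%E : \bar R) [set y | y < e%:E]%E.
  by apply: open_nbhs_nbhs; split; [exact: open_ereal_lt_ereal|rewrite /= lte_fin].
move=> /[swap] H /H {H}; rewrite /nbhs /=; apply: filterS => n /=.
rewrite -volE inver gt_eqF ?vol_gt0// lte_pdivrMr ?vol_gt0//.
by rewrite EFinM => /ltW.
Qed.

Lemma subset_integral_normc q (B C : set (borel G)) : measurable B -> measurable C ->
  continuous q -> B `<=` C ->
  (\int[haar]_(y in B) (normc (q y))%:E <= \int[haar]_(y in C) (normc (q y))%:E)%E.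
Proof.
move=> mB mC cq BC; apply: ge0_subset_integral => //.
- by apply/measurable_EFinP; apply: measurable_funTS; exact: measurable_normc.
- by move=> x _; rewrite lee_fin normc_ge0.
Qed.

Lemma integral_normc_bound q (M : R) (B : set (borel G)) : measurable B ->
  continuous q -> (forall x, normc (q x) <= M) ->
  (\int[haar]_(y in B) (normc (q y))%:E <= M%:E * haar B)%E.
Proof.
move=> mB cq qM; rewrite -integral_cst//; apply: ge0_le_integral => //.
- by move=> x _; rewrite lee_fin normc_ge0.
- by apply/measurable_EFinP; apply: measurable_funTS; exact: measurable_normc.
- by move=> x _; rewrite lee_fin.
Qed.

Lemma integral_normcU q (M : R) n K : compact K -> continuous q ->
  (forall x, normc (q x) <= M) ->
  (\int[haar]_(y in (A n `|` bd K n : set (borel G))) (normc (q y))%:E <=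
   \int[haar]_(y in (A n : set (borel G))) (normc (q y))%:E + M%:E * haar (bd K n))%E.
Proof.
move=> cK cq qM; have mbd := measurable_bd n cK.
rewrite -(setDUK (@subsetUl _ (A n : set (borel G)) (bd K n))).
have mD : measurable (((A n : set (borel G)) `|` bd K n) `\` A n).
  by apply: measurableD => //; exact: measurableU.
rewrite ge0_integral_setU//; last 3 first.
- by apply/measurable_EFinP; apply: measurable_funTS; exact: measurable_normc.
- by move=> x _; rewrite lee_fin normc_ge0.
- by apply/disj_setPS => x [? []].
rewrite leeD2l//; apply: le_trans (integral_normc_bound mbd cq qM).
by apply: subset_integral_normc => // x [[]].
Qed.

(** Points within [U - U] of [A n] lie in [A n] or in its boundary along [V], so the indicator of
    this union is an admissible [g] in [tv_le_integral]. The factor 2 allows for the boundary, whose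
    volume is eventually at most that of [A n]. *)
Lemma tv_le_vol mu : translation_bounded mu ->
  exists2 C : R, 0 <= C & \forall n \near \oo, tv mu (A n) <= C * vol n.
Proof.
move=> tb; have [U [oU U0] pU] := precompact_nbhs0 lcG.
have nU : nbhs (0 : G) U by exact: open_nbhs_nbhs.
have mU : measurable (U : set (borel G)) by exact: open_measurable_borel.
have haarU := haar_nbhs0_gt0 nU mU.
have [C C0 HC] := tv_le_integral haarH tb nU mU pU haarU.
pose V := minkowski_diff (closure U) (closure U).
have cV : compact V by apply: compact_minkowski_diff; rewrite -precompactE.
exists (C * 2); first by rewrite mulr_ge0.
have := bd_small cV (@ltr01 R); apply: filterS => n bdn.
have mS : measurable ((A n : set (borel G)) `|` bd V n).
  by apply: measurableU => //; exact: measurable_bd.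
rewrite -lee_fin; apply: le_trans
  (HC _ \1_((A n : set (borel G)) `|` bd V n) (mA n) (pA n) _ _ _) _.
- exact: measurable_indic.
- by move=> y; rewrite indicE.
- move=> b a y Ab Uba Uya; rewrite indicE mem_set//.
  rewrite (sub_decomp a b y).
  apply: bd_out => //; exists (y - a); first exact: subset_closure.
  by exists (b - a) => //; exact: subset_closure.
rewrite integral_indic// setIT -mulrA EFinM lee_wpmul2l ?lee_fin//.
apply: (@le_trans _ (\bar R) (haar (A n) + haar (bd V n))%E).
  by apply: measureU2 => //; exact: measurable_bd.
by rewrite mulrDl mul1r EFinD -volE leeD2l// (le_trans bdn)// mul1r.
Qed.

(* The constant of [cint_le_integral] grows like [1 / haar U] as [U] shrinks, so
   the oscillation [e1] of [h] on [U] must not be multiplied by it: it is paired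
   with [tv_le_vol], whose neighbourhood is fixed, and [d] is chosen after [U]. *)
Lemma cint_translate_small mu h (e : R) : translation_bounded mu -> Cu h -> 0 < e ->
  exists2 d : R, 0 < d & forall tau,
    (\forall n \near \oo,
      (\int[haar]_(y in (A n : set (borel G))) (normc (h y - translate tau h y))%:E
       <= (d * vol n)%:E)%E) ->
    forall s, \forall n \near \oo,
      normc (cint mu (A n) (translate s (fun y => h y - translate tau h y)))
      <= e * vol n.
Proof.
move=> tb Ch e0; have [C0 C00 tvC0] := tv_le_vol tb.
have [[M hM] hu] := Ch.
have M0 : 0 <= M by exact: le_trans (normc_ge0 _) (hM 0).
(* Chosen so that [e1 * tv mu (A n)] uses up half of [e * vol n]. *)
pose e1 := e / 2 / (C0 + 1).
have e10 : 0 < e1 by rewrite !divr_gt0// ltr_wpDl.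
(* Within a translate of [V] the function [h] varies by less than [e1 / 2]; the difference of [h]
   and its translate then varies by at most [e1], whatever [tau] is. *)
have [V [oV V0] VV] := sub_cvg0 (hu _ (divr_gt0 e10 (@ltr0Sn R 1))).
have [U0 [oU0 U00] pU0] := precompact_nbhs0 lcG.
pose U := V `&` U0.
have oU : open U by exact: openI.
have nU : nbhs (0 : G) U by apply: open_nbhs_nbhs.
have pU : precompact U by apply: precompact_subset pU0; exact: subIsetr.
have mU : measurable (U : set (borel G)) by exact: open_measurable_borel.
have haarU := haar_nbhs0_gt0 nU mU.
have [C CC HC] := cint_le_integral haarH tb nU mU pU haarU.
(* The other half of [e] is shared by the mean over [A n], through [d], and the boundary, through
   [d2]. *)
pose d := e / 4 / (C + 1); pose d2 := e / 4 / (2 * M * C + 1).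
have MC0 : 0 <= 2 * M * C by rewrite !mulr_ge0.
have d0 : 0 < d by rewrite !divr_gt0// ltr_wpDl.
have d20 : 0 < d2 by rewrite !divr_gt0// ltr_wpDl.
exists d => // tau htau s.
set q := fun y => h y - translate tau h y.
have Cq : Cu q by apply: CuB => //; exact: Cu_translate.
have cq := Cu_continuous Cq.
have qM x : normc (q x) <= 2 * M.
  by rewrite (le_trans (normcB _ _))// mulrDl mul1r lerD// hM.
have qe x y a : U (x - a) -> U (y - a) -> normc (q x) <= e1 + normc (q y).
  move=> [Vx _] [Vy _]; rewrite -lerBlDr; apply: le_trans (normc_ler_sub _ _) _.
  have hxy z : normc (h (x - z) - h (y - z)) <= e1 / 2.
    have := VV _ _ Vx Vy (y - z).
    by rewrite addrAC -sub_decomp => /ltW.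
  rewrite (_ : q x - q y = (h (x - 0) - h (y - 0)) - (h (x - tau) - h (y - tau))).
    by rewrite (le_trans (normcB _ _))// (splitr e1) lerD.
  by rewrite /q /translate !subr0; ring.
pose W := minkowski_diff (closure U) (closure U).
have cW : compact W by apply: compact_minkowski_diff; rewrite -precompactE.
(* The integrand at [b] in [A n] is [q (b - s)], so the points to average over lie in [A n + K].
   Since [K] depends on [s], so does the threshold on [n], but [d] does not. *)
pose K := [set - s + w | w in W].
have cK : compact K by exact: compact_shift.
apply: filterS3 tvC0 htau (bd_small cK d20) => n tvn qn bdn.
pose S : set (borel G) := (A n : set (borel G)) `|` bd K n.
have mS : measurable S by apply: measurableU => //; exact: measurable_bd.
have mnq : measurable_fun [set: borel G] (fun x : borel G => normc (q x)).
  exact: measurable_normc.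
have := HC (A n) (translate s q) (- s) e1 ((fun x : borel G => normc (q x)) \_ S).
have Ctq := Cu_translate s Cq.
move=> /(_ (mA n) (pA n) Ctq (ltW e10)).
have mg : measurable_fun setT ((fun x : borel G => normc (q x)) \_ S).
  by apply/(measurable_restrictT _ _).1 => //; exact: measurable_funTS.
have g0 y : 0 <= ((fun x : borel G => normc (q x)) \_ S) y.
  by rewrite patchE; case: ifPn => // _; exact: normc_ge0.
move=> /(_ mg g0) H.
have {}H := H _; rewrite -lee_fin.
apply: le_trans (H _) _ => [b a y Ab Uba Uya|].
  have Sy : S y.
    rewrite (sub_decomp (a - s) (b - s) y) -addrA; apply: bd_out => //.
    exists (y - (a - s) - (b - s - (a - s))) => //.
    exists (y - (a - s)).
      by apply: subset_closure; move: Uya; rewrite opprB opprK addrA.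
    exists (b - s - (a - s)) => //.
    by apply: subset_closure; rewrite opprB addrA subrK.
  rewrite patchE mem_set//; apply: (qe _ _ (a - s)).
    by rewrite opprB addrA subrK.
  by move: Uya; rewrite opprB opprK addrA.
rewrite (_ : (\int[haar]_y _ = \int[haar]_(y in S) (normc (q y))%:E)%E); last first.
  by rewrite [RHS]integral_mkcond; apply: eq_integral => y _; rewrite !patchE; case: ifP.
apply: (@le_trans _ (\bar R) ((e1 * tv mu (A n))%:E +
    C%:E * ((d * vol n)%:E + (2 * M)%:E * (d2 * vol n)%:E))%E).
  rewrite leeD2l// lee_wpmul2l ?lee_fin//.
  apply: le_trans (integral_normcU n cK cq qM) _.
  by apply: leeD => //; rewrite lee_wpmul2l// lee_fin mulr_ge0.
rewrite -[leLHS]/(e1 * tv mu (A n) +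
  C * (d * vol n + 2 * M * (d2 * vol n)))%:E lee_fin.
have v0 := vol_gt0 n.
have h1 : e1 * tv mu (A n) <= e / 2 * vol n.
  apply: (@le_trans _ _ (e1 * (C0 * vol n))); first by rewrite ler_wpM2l// ltW.
  by rewrite mulrA ler_wpM2r ?(ltW v0)// mulrC mulr_div_le// ltW// divr_gt0.
have h2 : C * d <= e / 4 by rewrite mulr_div_le// ltW// divr_gt0.
have h3 : 2 * M * C * d2 <= e / 4 by rewrite mulr_div_le// ltW// divr_gt0.
nra.
Qed.

(** The inner integrals over [A n] and over the whole group can differ at [b] only if some [b - l]
    with [l] in [K] leaves [A n]. All points near such a [b] belong to a van Hove boundary, so the
    bounded difference [k] has a negligible integral. *)
Lemma twisted_conv_boundary mu nu psi (e : R) : translation_bounded mu ->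
  translation_bounded nu -> Cc psi -> 0 < e ->
  \forall n \near \oo, normc (twisted_conv mu nu (A n) psi -
    cint mu (A n) (fun s => conjc (conv_on nu setT (fun x => conjc (psi x)) s)))
    <= e * vol n.
Proof.
move=> mutb nutb Cpsi e0; have Ccp := Cc_conj hausG Cpsi.
have [K cK K0] := Cc_support Cpsi.
have [M M0 HM] := conv_on_bound hausG nutb Ccp.
have [U [oU U0] pU] := precompact_nbhs0 lcG.
have nU : nbhs (0 : G) U by apply: open_nbhs_nbhs.
have mU : measurable (U : set (borel G)) by exact: open_measurable_borel.
have haarU := haar_nbhs0_gt0 nU mU.
have [C C0 HC] := cint_le_integral haarH mutb nU mU pU haarU.
pose W := minkowski_diff (closure U) (closure U).
have cW : compact W by apply: compact_minkowski_diff; rewrite -precompactE.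
(* A point [y] near [b] outside [A n] is reached from [b] by an element of [W]; if [y] is inside, it
   is reached from the outer point [b - l] by subtracting an element of [- K - W]. *)
pose L := W `|` minkowski_diff (-%R @^-1` K) W.
have cL : compact L.
  apply: compactU => //; apply: compact_minkowski_diff => //; exact: compact_opp.
have MC0 : 0 <= 2 * M * C by rewrite !mulr_ge0.
have d0 : 0 < e / (2 * M * C + 1) by rewrite divr_gt0// ltr_wpDl.
have := bd_small cL d0; apply: filterS => n bdn.
pose k s := conjc (conv_on nu (A n) (fun x => conjc (psi x)) s) -
            conjc (conv_on nu setT (fun x => conjc (psi x)) s).
have Cn B : measurable (B : set (borel G)) ->
    Cu (fun s => conjc (conv_on nu B (fun x => conjc (psi x)) s)).
  by move=> mB; apply: Cu_conj; exact: Cu_conv_on.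
have Ck : Cu k by apply: CuB; exact: Cn.
rewrite /twisted_conv -cintB//; last 2 first.
- exact: (Cn (A n)).
- exact: Cn.
have mbd := measurable_bd n cL.
rewrite -lee_fin.
apply: le_trans (HC (A n) k 0 0 (fun y => 2 * M * \1_(bd L n) y) (mA n) (pA n) Ck _ _ _ _) _.
- by [].
- by apply: measurable_funM => //; exact: measurable_indic.
- by move=> y; rewrite !mulr_ge0// indicE.
- move=> b a y Ab Uba; rewrite subr0 add0r => Uya.
  have [[l Kl nAbl]|KA] := pselect (exists2 l, K l & ~ A n (b - l)); last first.
    rewrite /k -rmorphB normcJ (_ : _ - _ = 0) ?normc0 ?mulr_ge0 ?indicE//.
    apply/eqP; rewrite subr_eq0; apply/eqP/esym; apply: cint_supported => //.
    move=> r _ nAr; rewrite K0 ?rmorph0// => Kbr; apply: KA; exists (b - r) => //.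
    by rewrite subKr.
  have Wyb : W ((y - a) - (b - a)).
    by exists (y - a); [exact: subset_closure|exists (b - a) => //; exact: subset_closure].
  rewrite indicE mem_set; last first.
    have [Ay|nAy] := pselect (A n y); last first.
      have := @bd_out L n b ((y - a) - (b - a)) Ab (or_introl Wyb).
      by rewrite -sub_decomp => -[].
    have yE : y = b - l - (- l - ((y - a) - (b - a))).
      by rewrite opprD !opprK addrA subrK -sub_decomp.
    rewrite yE; apply: bd_in => //; last by rewrite -yE.
    by right; exists (- l); [rewrite /= opprK|exists ((y - a) - (b - a))].
  rewrite mulr1 (le_trans (normcB _ _))// mulrDl mul1r !normcJ lerD//; exact: HM.
rewrite mul0r add0e.
under eq_integral do rewrite EFinM.
rewrite ge0_integralZl//; last 2 first.
- by apply/measurable_EFinP; exact: measurable_indic.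
- by rewrite lee_fin mulr_ge0.
rewrite integral_indic// setIT muleA -EFinM.
apply: (@le_trans _ (\bar R) ((C * (2 * M))%:E * (e / (2 * M * C + 1) * vol n)%:E)%E).
  by rewrite lee_wpmul2l// lee_fin !mulr_ge0.
rewrite -EFinM lee_fin (mulrA (C * (2 * M))) [C * _]mulrC.
by rewrite ler_wpM2r ?(ltW (vol_gt0 n))// mulr_div_le// ltW.
Qed.

End VanHove.

(** * Bohr and strong almost periodicity *)

Section BohrAlmostPeriodicity.
Context {G : topologicalZmodType} {R : realType}.
Implicit Types f F : G -> R[i].

Definition bohr_almost_periodic F := Cu F /\
  forall e : R, 0 < e ->
    relatively_dense [set t | forall x, normc (F x - F (x + t)) <= e].

Lemma relatively_denseS (S T : set G) : S `<=` T ->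
  relatively_dense S -> relatively_dense T.
Proof.
move=> ST [K cK SK]; exists K => //; apply/seteqP; split => // x _.
have : [set: G] x by []; rewrite -SK => -[s Ss [k Kk <-]].
by exists s; [exact: ST|exists k].
Qed.

Lemma bohr_star F : bohr_almost_periodic F -> bohr_almost_periodic (star F).
Proof.
move=> [CF Fp]; split; first exact: Cu_star.
move=> e e0; apply: relatively_denseS (Fp e e0) => t Ft x.
rewrite /star -rmorphB normcJ normc_distC.
by have := Ft (- (x + t)); rewrite {2}opprD subrK.
Qed.

End BohrAlmostPeriodicity.

(** * Bohr almost periodicity of the limit function *)

Section EberleinLimit.
Context {G : topologicalZmodType} {R : realType}.
Hypothesis hausG : hausdorff_space G.
Hypothesis lcG : locally_compact [set: G].
Variables (haar : radon G R) (A : nat -> set G).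
Hypothesis haarH : is_haar haar.
Hypothesis vanHoveA : van_hove haar A.
Implicit Types (f g h F : G -> R[i]) (mu nu : cradon G R).

Let oA n : open (A n). Proof. by have [+ _ _ _] := vanHoveA; exact. Qed.
Let pA n : precompact (A n). Proof. by have [_ + _ _] := vanHoveA; exact. Qed.
Let mA n : measurable (A n : set (borel G)).
Proof. exact: open_measurable_borel. Qed.
Local Notation vol := (vol haar A).

Lemma cvg_normc_le (u v : nat -> R[i]) x y (c : R) :
  u @ \oo --> x -> v @ \oo --> y ->
  (\forall n \near \oo, normc (u n - v n) <= c) -> normc (x - y) <= c.
Proof.
move=> /cvg_normcP ux /cvg_normcP vy uvc; apply/ler_addgt0Pr => e e0.
have e20 : 0 < e / 2 by rewrite divr_gt0.
have /filter_ex[n [uxn vyn uvn]] : \forall n \near \oo,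
    [/\ normc (x - u n) < e / 2, normc (y - v n) < e / 2 & normc (u n - v n) <= c].
  by apply: filterS3 (ux _ e20) (vy _ e20) uvc => n.
apply: le_trans (normc_triangle _ (u n) _) _.
have := normc_triangle (u n) (v n) y; rewrite (normc_distC (v n) y).
lra.
Qed.

(** The seminorm condition on almost periods written as an eventual bound on integrals, the form
    required by [cint_translate_small]. *)
Definition mean_period f (e : R) : set G := [set t |
  \forall n \near \oo, (\int[haar]_(y in (A n : set (borel G)))
    (normc (f y - translate t f y))%:E <= (e * vol n)%:E)%E].

Lemma normc_vol n (z : R[i]) (c : R) : normc z <= c * vol n ->
  normc (((vol n)^-1)%:C * z) <= c.
Proof.
have v0 := vol_gt0 vanHoveA n.
rewrite normcM normc_real ger0_norm ?invr_ge0 ?(ltW v0)//.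
by rewrite ler_pdivrMl// mulrC.
Qed.

Lemma normc_vol_lt n (x y z : R[i]) (e : R) :
  normc (z - ((vol n)^-1)%:C * x) < e / 2 -> normc (x - y) <= e / 2 * vol n ->
  normc (z - ((vol n)^-1)%:C * y) < e.
Proof.
move=> h1 /normc_vol h2.
apply: le_lt_trans (normc_triangle _ (((vol n)^-1)%:C * x) _) _.
by rewrite (splitr e) -mulrBr ltr_leD.
Qed.

Lemma limit_bohr mu h F : translation_bounded mu -> Cu h ->
  (forall e : R, 0 < e -> relatively_dense (mean_period h e)) ->
  (forall s, ((vol n)^-1)%:C * cint mu (A n) (translate s h) @[n --> \oo] --> F s) ->
  bohr_almost_periodic F.
Proof.
move=> tb Ch hp hF; have [C C0 tvC] := tv_le_vol lcG haarH vanHoveA tb.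
have [[M hM] hu] := Ch.
have M0 : 0 <= M by exact: le_trans (normc_ge0 _) (hM 0).
have Cth s := Cu_translate s Ch.
(* The threshold on [n] may depend on [s] and [s']; it disappears in the limit, so bounds on [F]
   become uniform. *)
have dist s s' (c : R) : (\forall n \near \oo,
    normc (cint mu (A n) (fun x => translate s h x - translate s' h x))
      <= c * vol n) -> normc (F s - F s') <= c.
  move=> H; apply: cvg_normc_le (hF s) (hF s') _.
  by apply: filterS H => n Hn; rewrite -mulrBr -cintB//; exact: normc_vol.
split; [split|].
- exists (M * C) => s; rewrite -[F s]subr0.
  apply: cvg_normc_le (hF s) (cvg_cst 0) _.
  apply: filterS tvC => n tvn; rewrite subr0; apply: normc_vol.
  apply: le_trans (cint_tv mu (mA n) (pA n) (Cth s) M0 _) _.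
    by move=> x _; exact: hM.
  by rewrite -mulrA ler_wpM2l.
- move=> e e0; pose e1 := e / 2 / (C + 1).
  have e10 : 0 < e1 by rewrite !divr_gt0// ltr_wpDl.
  have := nbhs0N (hu _ e10); apply: filterS => u hu1 s.
  apply: (@le_lt_trans _ _ (e / 2)); last by rewrite ltr_pdivrMr// ltr_pMr// ltr1n.
  apply: dist; apply: filterS tvC => n tvn.
  apply: le_trans (cint_tv mu (mA n) (pA n) (CuB (Cth _) (Cth _)) (ltW e10) _) _.
    by move=> x _; rewrite /translate opprD addrA; exact/ltW/hu1.
  apply: (@le_trans _ _ (e1 * (C * vol n))); first by rewrite ler_wpM2l// ltW.
  rewrite mulrA ler_wpM2r ?(ltW (vol_gt0 vanHoveA n))// mulrC.
  by rewrite mulr_div_le// ltW// divr_gt0.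
- move=> e e0.
  have [d d0 hd] := cint_translate_small lcG haarH vanHoveA tb Ch e0.
  apply: relatively_denseS (hp d d0) => t /hd ht s; apply: dist.
  apply: filterS (ht s) => n; congr (normc (cint _ _ _) <= _).
  by apply/funext => x; rewrite /translate opprD addrA.
Qed.

Lemma bnorm_lt f (e : R) : (bnorm haar A f < e%:E)%E ->
  \forall n \near \oo, (\int[haar]_(y in (A n : set (borel G))) (normc (f y))%:E
    <= (e * vol n)%:E)%E.
Proof.
move=> /ereal_inf_lt[_ [V oV <-]] supV; apply: filterS oV => n Vn.
have : (\int[haar]_(y in (A n : set (borel G))) (normc (f y))%:E / haar (A n)
    <= e%:E)%E.
  by apply: le_trans (ltW supV); apply: ereal_sup_ubound; exists n.
have v0 := vol_gt0 vanHoveA n.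
by rewrite -(volE vanHoveA) inver gt_eqF// lee_pdivrMr.
Qed.

Lemma integral_translate (t : G) (B : set (borel G)) f : measurable B ->
  continuous f ->
  (\int[haar]_(y in B) (normc (translate t f y))%:E =
   \int[haar]_(y in ([set y : G | B (y + t)%R] : set (borel G))) (normc (f y))%:E)%E.
Proof.
move=> mB cf; pose p : borel G -> borel G := fun y : G => y - t.
have mp : measurable_fun [set: borel G] p by exact: measurable_subr.
pose D : set (borel G) := [set y : G | B (y + t)%R].
have mD : measurable D.
  have := measurable_shift (- t) mB; congr measurable.
  by apply/funext => y; rewrite /= opprK.
have pD : p @^-1` D = B by apply/seteqP; split => y; rewrite /p /D /= subrK.
have mf : measurable_fun [set: borel G] (fun y : borel G => (normc (f y))%:E).
  by apply/measurable_EFinP; exact: measurable_normc.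
transitivity (\int[pushforward haar p]_(y in D) (normc (f y))%:E)%E.
  rewrite [RHS](ge0_integral_pushforward mp)// ?pD//.
    exact: measurable_funTS.
  by move=> y _; rewrite lee_fin normc_ge0.
apply: eq_measure_integral => /= S mS _.
rewrite /pushforward -(haar_shift haarH t mS).
by [].
Qed.

(** An almost period of a close [g] in [MAP] is one of [f], by splitting into [f - g],
    [g - translate t g] and the translate of [f - g]. The first two means take [e / 4] each; the
    third takes [e / 2], of which one half is the boundary error. *)
Lemma Map1_mean_period f (e : R) : Cu f -> Map1 haar A f -> 0 < e ->
  relatively_dense (mean_period f e).
Proof.
move=> Cf [_ fM] e0; have e40 : 0 < e / 4 by rewrite divr_gt0.
have [g [Cg gM] fg] := fM _ e40.
apply: relatively_denseS (gM _ e40) => t gt.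
have Cfg : Cu (fun x => f x - g x) by exact: CuB.
have [[M fgM] _] := Cfg.
have M0 : 0 <= M by exact: le_trans (normc_ge0 _) (fgM 0).
have d0 : 0 < e / 4 / (M + 1) by rewrite divr_gt0// ltr_wpDl.
(* Translating the integrand moves the domain to [A n - t], which lies in [A n] together with its
   boundary along this one point. *)
pose K : set G := [set - t].
have ct : compact K by exact: compact_set1.
apply: filterS3 (bnorm_lt fg) (bnorm_lt gt) (bd_small vanHoveA ct d0) => n fgn gtn bdn.
have cfg := Cu_continuous Cfg.
have mabs q : Cu q -> measurable_fun (A n : set (borel G))
    (fun y : borel G => (normc (q y))%:E).
  move=> /Cu_continuous cq; apply/measurable_EFinP; apply: measurable_funTS.
  exact: measurable_normc.
have Cgt : Cu (fun x => g x - translate t g x) by apply: CuB => //; exact: Cu_translate.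
have Ctfg := Cu_translate t Cfg.
have tfgn : (\int[haar]_(y in (A n : set (borel G)))
    (normc (translate t (fun x => f x - g x) y))%:E <= (e / 2 * vol n)%:E)%E.
  rewrite integral_translate//.
  apply: (@le_trans _ (\bar R)
      (\int[haar]_(y in ((A n : set (borel G)) `|` bd A K n))
        (normc (f y - g y))%:E)%E).
    have mbd := measurable_bd vanHoveA n ct.
    apply: subset_integral_normc => //.
    - have := measurable_shift (- t) (mA n); congr measurable.
      by apply/funext => y; rewrite /= opprK.
    - exact: measurableU.
    - move=> y Ayt; have := @bd_out _ A K n _ _ Ayt erefl.
      by rewrite addrK.
  apply: le_trans (integral_normcU vanHoveA n ct cfg fgM) _.
  apply: (@le_trans _ (\bar R) ((e / 4 * vol n)%:E + M%:E * (e / 4 / (M + 1) * vol n)%:E)%E).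
    by apply: leeD => //; rewrite lee_wpmul2l.
  rewrite -[leLHS]/(e / 4 * vol n + M * (e / 4 / (M + 1) * vol n))%:E lee_fin.
  have v0 := vol_gt0 vanHoveA n.
  have : M * (e / 4 / (M + 1)) <= e / 4 by rewrite mulr_div_le// ltW.
  nra.
apply: (@le_trans _ (\bar R) (\int[haar]_(y in (A n : set (borel G)))
  ((normc (f y - g y))%:E + ((normc (g y - translate t g y))%:E +
   (normc (translate t (fun x => f x - g x) y))%:E)))%E).
  apply: ge0_le_integral => //.
  - by move=> y _; rewrite lee_fin normc_ge0.
  - by apply: mabs; apply: CuB => //; exact: Cu_translate.
  - by apply: emeasurable_funD; [exact: mabs|apply: emeasurable_funD; exact: mabs].
  - move=> y _; rewrite -!EFinD lee_fin.
    apply: le_trans (normc_triangle _ (g y) _) _; rewrite lerD2l.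
    apply: le_trans (normc_triangle _ (translate t g y) _) _; rewrite lerD2l.
    by rewrite normc_distC.
rewrite ge0_integralD//; last 4 first.
- by move=> y _; rewrite lee_fin normc_ge0.
- exact: mabs.
- by move=> y _; rewrite -EFinD lee_fin addr_ge0 ?normc_ge0.
- by apply: emeasurable_funD; exact: mabs.
rewrite ge0_integralD//; last 4 first.
- by move=> y _; rewrite lee_fin normc_ge0.
- exact: mabs.
- by move=> y _; rewrite lee_fin normc_ge0.
- exact: mabs.
apply: le_trans (leeD fgn (leeD gtn tfgn)) _.
rewrite -!EFinD lee_fin; have v0 := vol_gt0 vanHoveA n; lra.
Qed.

Lemma mean_period_conj f (e : R) :
  mean_period (fun x => conjc (f x)) e = mean_period f e.
Proof.
have E t n : (\int[haar]_(y in (A n : set (borel G)))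
      (normc (conjc (f y) - translate t (fun x => conjc (f x)) y))%:E =
    \int[haar]_(y in (A n : set (borel G))) (normc (f y - translate t f y))%:E)%E.
  apply: eq_integral => y _; congr EFin.
  by rewrite -[RHS]normcJ; congr normc; rewrite rmorphB.
by apply/seteqP; split => t /=; apply: filterS => n; rewrite E.
Qed.

(** Stated for a limit function [F], not for a measure, so that it also applies after the exchange
    of [mu] and [nu], where the limit is [star (conv_fun lambda phi)]. *)
Lemma twisted_limit_bohr mu nu phi F : translation_bounded mu ->
  translation_bounded nu -> Cc phi ->
  Map1 haar A (conv_fun nu (star phi)) ->
  (forall t, ((vol n)^-1)%:C * twisted_conv mu nu (A n) (fun x => phi (t - x))
     @[n --> \oo] --> F t) ->
  bohr_almost_periodic F.
Proof.
move=> mutb nutb Cphi nuM hF; have Csphi := Cc_star hausG Cphi.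
have Cconv : Cu (conv_fun nu (star phi)).
  exact: (Cu_conv_on hausG lcG nutb (@measurableT _ (borel G)) Csphi).
pose h x := conjc (conv_fun nu (star phi) x).
apply: (limit_bohr mutb (Cu_conj Cconv)).
  by move=> e e0; rewrite mean_period_conj; exact: Map1_mean_period.
move=> t; apply/cvg_normcP => e e0; have e20 : 0 < e / 2 by rewrite divr_gt0.
have /cvg_normcP/(_ _ e20) h1 := hF t.
have Cpt := Cc_reflect hausG t Cphi.
have := twisted_conv_boundary hausG lcG haarH vanHoveA mutb nutb Cpt e20.
have hE s : conjc (conv_on nu setT (fun x => conjc (phi (t - x))) s) =
    translate t h s.
  rewrite /translate /h /conv_on /conv_fun; congr (conjc (cint _ _ _)).
  apply/funext => r; rewrite /star; congr (conjc (phi _)).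
  by rewrite !opprB addrCA.
have -> : translate t h = (fun s =>
    conjc (conv_on nu setT (fun x => conjc (phi (t - x))) s)).
  by apply/funext => s; rewrite hE.
by apply: filterS2 h1 => n; exact: normc_vol_lt.
Qed.

End EberleinLimit.

(** * From Bohr to strong almost periodicity *)

Section StrongAlmostPeriodicity.
Context {G : topologicalZmodType} {R : realType}.
Hypothesis hausG : hausdorff_space G.
Implicit Types F f g : G -> R[i].

Lemma uniform_nbhs_normc (f : {uniform G -> R[i]}) (P : set {uniform G -> R[i]}) :
  nbhs f P <-> exists2 e : R, 0 < e &
    forall g : {uniform G -> R[i]}, (forall x, normc (f x - g x) < e) -> P g.
Proof.
rewrite uniform_nbhs; split=> [[E [entE EP]]|[e e0 eP]].
  have [e e0 eE] : exists2 e : R[i], 0 < e &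
      forall x y : R[i], `|x - y| < e -> E (x, y).
    move: entE; rewrite -entourage_ballE => -[e e0 eE]; exists e => // x y xy.
    by apply: eE; rewrite /= -ball_normE.
  move: (e0); rewrite ltcE => /andP[/eqP ie re].
  exists (complex.Re e) => // g fg; apply: EP => y _; apply: eE.
  by rewrite -normc_norm ltcE /= ie eqxx /=; exact: fg.
exists [set xy : R[i] * R[i] | `|xy.1 - xy.2| < e%:C]; split.
  rewrite -entourage_ballE; exists e%:C; first by rewrite /= ltcR.
  by move=> [x y]; rewrite /= -ball_normE.
by move=> g fg; apply: eP => x; have := fg x I; rewrite /= -normc_norm ltcR.
Qed.

(** Every [s] is [u + k] with [u] an almost period and [k] in the compact [K], so translating by [s]
    is nearly translating by [k], and [k] is close to one of finitely many [t i]. Passing to the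
    closure costs a third [e / 4]. *)
Lemma bohr_totally_bounded F (e : R) : bohr_almost_periodic F -> 0 < e ->
  exists n (t : nat -> G), forall g,
    closure (range (translate ^~ F : G -> {uniform G -> R[i]})) g ->
    exists2 i : 'I_n, True & forall x, normc (g x - translate (t i) F x) <= e.
Proof.
move=> [[_ Fu] Fp] e0; have e40 : 0 < e / 4 by rewrite divr_gt0.
have [K cK SK] := Fp _ e40.
have [n [t Kt]] := precompact_cover (compact_precompact hausG cK) (Fu _ e40).
exists n, t => g clg.
have /clg[_ [[s _ <-] gs]] : nbhs (g : {uniform G -> R[i]})
    [set h : {uniform G -> R[i]} | forall x, normc (g x - h x) < e / 4].
  by apply/uniform_nbhs_normc; exists (e / 4).
have : [set: G] s by [].
rewrite -SK => -[u /= Su [k Kk uk]]; have [i /= ni ti] := Kt k Kk.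
exists (Ordinal ni) => // x /=.
have h1 := gs x; have h2 := Su (x - s); have h3 := ti (x - k).
rewrite -uk /translate in h1 h2 *.
have E1 : x - (u + k) + u = x - k by rewrite opprD addrA addrAC subrK.
have E2 : x - k + (k - t i) = x - t i by rewrite addrA subrK.
rewrite E1 in h2; rewrite E2 normc_distC in h3.
apply: le_trans (normc_triangle _ (F (x - (u + k))) _) _.
have := normc_triangle (F (x - (u + k))) (F (x - k)) (F (x - t i)).
lra.
Qed.

(** Total boundedness and completeness, phrased with ultrafilters: an ultrafilter on the orbit
    closure is Cauchy for uniform distance, converges pointwise, hence uniformly, and its limit
    stays in the closure and in [Cu]. *)
Lemma bohr_strongly_almost_periodic F :
  bohr_almost_periodic F -> strongly_almost_periodic_fun F.
Proof.
move=> bF; have [CF _] := bF; split => //.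
set O := (X in closure X).
rewrite compact_ultra => FF UF FK.
have PF : ProperFilter FF by exact: ultra_proper.
have meet (P Q : set {uniform G -> R[i]}) :
    FF P -> FF Q -> exists g, P g /\ Q g.
  by move=> FP FQ; apply: (@filter_ex _ FF _ (P `&` Q)); exact: filterI.
have small (e : R) : 0 < e -> exists2 D : set {uniform G -> R[i]}, FF D &
    forall f g, D f -> D g -> forall x, normc (f x - g x) <= e.
  move=> e0; have e20 : 0 < e / 2 by rewrite divr_gt0.
  have [n [t Ot]] := bohr_totally_bounded bF e20.
  pose B i : set {uniform G -> R[i]} :=
    [set g | forall x, normc (g x - translate (t i) F x) <= e / 2].
  (* One of the finitely many balls belongs to the ultrafilter: otherwise all their complements do,
     and so the orbit closure would have a point that no ball covers. *)
  have [[i FBi]|nB] := pselect (exists i : 'I_n, FF (B i)).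
    exists (B i) => // f g Bf Bg x.
    apply: le_trans (normc_triangle _ (translate (t i) F x) _) _.
    by rewrite (splitr e) lerD// normc_distC.
  have nBi (i : 'I_n) : FF (~` B i).
    by have [FB|//] := in_ultra_setVsetC (B i) UF; case: nB; exists i.
  have : FF [set g | forall i : 'I_n, (~` B i) g] by exact: filter_forall.
  move=> FnB; have [g [[clg _] nBg]] := meet _ _ FK FnB.
  by have [i _ Big] := Ot _ clg; case: (nBg i).
(* Used for the real and the imaginary part, so that only completeness of the reals is invoked. *)
have lims (r : R[i] -> R) : (forall z w, `|r z - r w| <= normc (z - w)) ->
    exists p : G -> R, forall (e : R) (D : set {uniform G -> R[i]}), FF D ->
      (forall f g, D f -> D g -> forall x, normc (f x - g x) <= e) ->
      forall g x, D g -> `|r (g x) - p x| <= e.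
  move=> rL.
  have cv x : cvg ((fun f : {uniform G -> R[i]} => r (f x)) @ FF).
    apply/cauchy_cvgP; apply: cauchy_exP => e e0.
    have e20 : 0 < e / 2 by rewrite divr_gt0.
    have [D FD De] := small _ e20; have /filter_ex[g Dg] := FD.
    exists (r (g x)).
    suff : FF [set f : {uniform G -> R[i]} | ball (r (g x)) e (r (f x))] by [].
    apply: filterS FD => f Df.
    rewrite /= -ball_normE /=; apply: le_lt_trans (rL _ _) _.
    by apply: le_lt_trans (De _ _ Dg Df x) _; rewrite ltr_pdivrMr// ltr_pMr// ltr1n.
  exists (fun x => lim ((fun f : {uniform G -> R[i]} => r (f x)) @ FF)).
  move=> e D FD De g x Dg; apply/ler_addgt0Pr => d d0.
  have /cvgrPdist_lt/(_ d d0) lf := cv x.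
  have [f [{}lf Df]] := meet _ _ lf FD.
  apply: le_trans (ler_distD (r (f x)) _ _) _.
  apply: lerD; first by apply: le_trans (rL _ _) _; exact: De.
  by rewrite distrC ltW.
have [|pr Hpr] := lims (@complex.Re R).
  by move=> [a b] [c d]; exact: (normr_Re ((a +i* b) - (c +i* d))).
have [|pi Hpi] := lims (@complex.Im R).
  by move=> [a b] [c d]; exact: (normr_Im ((a +i* b) - (c +i* d))).
pose p : {uniform G -> R[i]} := fun x => pr x +i* pi x.
have near_p (e : R) : 0 < e -> exists2 D : set {uniform G -> R[i]}, FF D &
    forall g, D g -> forall x, normc (p x - g x) < e.
  move=> e0; have e30 : 0 < e / 3 by rewrite divr_gt0.
  have [D FD De] := small _ e30; exists D => // g Dg x.
  have h1 := Hpr _ _ FD De g x Dg; have h2 := Hpi _ _ FD De g x Dg.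
  rewrite normc_distC; apply: le_lt_trans (normc_ReIm _) _.
  have -> : complex.Re (g x - p x) = complex.Re (g x) - pr x by case: (g x).
  have -> : complex.Im (g x - p x) = complex.Im (g x) - pi x by case: (g x).
  lra.
have FFp : FF --> p.
  move=> P /uniform_nbhs_normc[e e0 eP]; have [D FD De] := near_p _ e0.
  by apply: filterS FD => g Dg; apply: eP; exact: De.
exists p; split => //; split.
  rewrite (closure_id (closure O)).1; last exact: closed_closure.
  by move=> B /FFp FB; have [g [[clg _] Bg]] := meet _ _ FK FB; exists g.
(* Boundedness and uniform continuity pass to [p] from a uniformly close member of [Cu]. *)
split.
  have [D FD D1] := near_p 1 ltr01.
  have [g [[_ [[M gM] _]] Dg]] := meet _ _ FK FD.
  exists (M + 1) => x.
  have := normcD (p x - g x) (g x); rewrite subrK => /le_trans; apply.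
  by rewrite addrC lerD// ltW// D1.
move=> e e0; have e30 : 0 < e / 3 by rewrite divr_gt0.
have [D FD De] := near_p _ e30.
have [g [[_ [_ gu]] Dg]] := meet _ _ FK FD.
apply: filterS (gu _ e30) => u hu x.
have h1 := De g Dg x; have h2 := De g Dg (x + u); have h3 := hu x.
rewrite normc_distC in h1.
have t1 := normc_triangle (p (x + u)) (g (x + u)) (p x).
have t2 := normc_triangle (g (x + u)) (g x) (p x).
lra.
Qed.

End StrongAlmostPeriodicity.

(** * Conjugated limits and the two cases of the theorem *)

Section Conclusion.
Context {G : topologicalZmodType} {R : realType}.
Implicit Types (f F : G -> R[i]) (mu nu : cradon G R).

Lemma starK f : star (star f) = f.
Proof. by apply/funext => x; rewrite /star conjcK opprK. Qed.

Lemma conv_restr_twisted mu nu (B : set (borel G)) f : measurable B ->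
  precompact (B : set G) -> Cu f ->
  conv_restr mu B (cstar nu) [set - x | x in B] f = twisted_conv mu nu B f.
Proof.
move=> mB pB Cf; rewrite /conv_restr /twisted_conv; congr (cint _ _ _).
by apply/funext => s; rewrite cint_cstar//; exact: Cu_shift.
Qed.

Lemma eq_cvg_to (u v : nat -> R[i]) (z : R[i]) :
  (forall n, u n = v n) -> u @ \oo --> z -> v @ \oo --> z.
Proof. by move=> /funext ->. Qed.

Lemma cvg_conjc (c : nat -> R) (u : nat -> R[i]) (z : R[i]) :
  (c n)%:C * u n @[n --> \oo] --> z ->
  (c n)%:C * conjc (u n) @[n --> \oo] --> conjc z.
Proof.
move=> /cvg_normcP uz; apply/cvg_normcP => e /uz; apply: filterS => n.
have E : conjc (z - (c n)%:C * u n) = conjc z - (c n)%:C * conjc (u n).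
  by case: z {uz} (u n) => a b [x y]; simpc; congr Complex; ring.
by rewrite -E normcJ.
Qed.

End Conclusion.

Theorem theorem4p20 (R : realType) (G : topologicalZmodType)
    (G_hausdorff : hausdorff_space G)
    (G_locally_compact : locally_compact [set: G]%classic)
    (G_second_countable : @second_countable G)
    (haar : radon G R) (haar_is_haar : is_haar haar)
    (A : nat -> set G) (A_van_hove : van_hove haar A)
    (mu nu : cradon G R)
    (mu_tb : translation_bounded mu) (nu_tb : translation_bounded nu)
    (lambda : cradon G R)
    (lambda_lim : twisted_eberlein_convolution haar A mu nu lambda) :
  (mean_almost_periodic haar A mu -> strongly_almost_periodic lambda) /\
  (mean_almost_periodic haar A nu -> strongly_almost_periodic lambda).
Proof.
have oA n : open (A n) by have [+ _ _ _] := A_van_hove; exact.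
have pA n : precompact (A n) by have [_ + _ _] := A_van_hove; exact.
have mA n : measurable (A n : set (borel G)) by exact: open_measurable_borel.
have lim phi t : Cc phi ->
    ((vol haar A n)^-1)%:C * twisted_conv mu nu (A n) (fun x => phi (t - x))
      @[n --> \oo] --> conv_fun lambda phi t.
  move=> Cphi; have Cpt := Cc_reflect G_hausdorff t Cphi.
  apply: (@eq_cvg_to _ (fun n => ((fine (haar (A n)))^-1)%:C * conv_restr mu (A n)
    (cstar nu) [set - x | x in A n] (fun s => phi (t - s))) _ _ _ (lambda_lim _ Cpt)).
  by move=> n; rewrite (conv_restr_twisted _ _ (mA n) (pA n) (Cc_Cu Cpt)).
split=> [muM|nuM] phi Cphi; apply: bohr_strongly_almost_periodic => //.
  (* By [twisted_convC], the value at [t] of [star (conv_fun lambda phi)], the conjugate of the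
     value at [- t], is the limit for [nu] and [mu] exchanged and [star phi] as test function. The
     measure required to be mean almost periodic is then [mu]. *)
  rewrite -[conv_fun _ _]starK; apply: bohr_star.
  have Csphi := Cc_star G_hausdorff Cphi.
  apply: (twisted_limit_bohr G_hausdorff G_locally_compact haar_is_haar A_van_hove
    nu_tb mu_tb Csphi) => [|t].
    by apply: muM; exact: Cc_star.
  apply: (@eq_cvg_to _ (fun n => ((vol haar A n)^-1)%:C *
    conjc (twisted_conv mu nu (A n) (fun x => phi (- t - x)))) _ _ _
    (cvg_conjc (lim phi (- t) Cphi))) => n.
  have Cpt := Cc_reflect G_hausdorff (- t) Cphi.
  rewrite (twisted_convC G_hausdorff G_locally_compact mu_tb nu_tb (mA n) (pA n) Cpt).
  rewrite conjcK; congr (_ * twisted_conv _ _ _ _).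
  by apply/funext => x; rewrite /star opprB opprK addrC.
apply: (twisted_limit_bohr G_hausdorff G_locally_compact haar_is_haar A_van_hove
  mu_tb nu_tb Cphi) => [|t].
  by apply: nuM; exact: Cc_star.
exact: lim.
Qed.
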